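(* Every hyperfinite factorial tracially complete $C^*$-algebra satisfies CPoU.
   Context: A trace means a tracial state; $T(A)$ is the set of traces on $A$ with the weak$^*$ topology, and $\|a\|_{2,X}=\sup_{\tau\in X}\tau(a^*a)^{1/2}$ for $X\subseteq T(A)$. A tracially complete $C^*$-algebra is a pair $(\mathcal M,X)$ where $\mathcal M$ is a $C^*$-algebra and $X\subseteq T(\mathcal M)$ is compact and convex such that $\|\cdot\|_{2,X}$ is a norm and the operator-norm closed unit ball of $\mathcal M$ is $\|\cdot\|_{2,X}$-complete ($\mathcal M$ is then automatically unital). It is factorial if $X$ is a closed face of $T(\mathcal M)$. It is hyperfinite if for every finite $\mathcal F\subseteq\mathcal M$ and $\epsilon>0$ there is a finite dimensional $C^*$-subalgebra $F\subseteq\mathcal M$ such that for every $a\in\mathcal F$ there is $b\in F$ with $\|a-b\|_{2,X}<\epsilon$. Reduced powers: let $\omega$ be a free filter on $\mathbb N$ (the choice is irrelevant). $\mathcal M^\omega=\ell^\infty(\mathcal M)/\{(a_n):\lim_{n\to\omega}\|a_n\|_{2,X}=0\}$, and $X^\omega\subseteq T(\mathcal M^\omega)$ is the weak$^*$-closed convex hull of the limit traces $(a_n)_n\mapsto\lim_{n\to\omega'}\tau_n(a_n)$, over all sequences $(\tau_n)$ in $X$ and all ultrafilters $\omega'\supseteq\omega$; $\mathcal M\subseteq\mathcal M^\omega$ via constant sequences. CPoU (complemented partitions of unity), for factorial $(\mathcal M,X)$: for every $\|\cdot\|_{2,X}$-separable $S\subseteq\mathcal M$, all positive $a_1,\dots,a_k\in\mathcal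 M$ and every scalar $\delta>\sup_{\tau\in X}\min_{1\le i\le k}\tau(a_i)$, there are orthogonal projections $p_1,\dots,p_k\in\mathcal M^\omega\cap S'$ summing to $1_{\mathcal M^\omega}$ with $\tau(a_ip_i)\le\delta\tau(p_i)$ for all $\tau\in X^\omega$ and $i=1,\dots,k$. *)

(* Defs.v *)
From HB Require Import structures.
From mathcomp Require Import all_boot all_order all_algebra.
From mathcomp Require Import generic_quotient ring_quotient.
From mathcomp Require Import complex.
From mathcomp Require Import all_classical all_reals all_analysis.
From mathcomp Require Import ring lra.

Set Implicit Arguments.
Unset Strict Implicit.
Unset Printing Implicit Defensive.

Import Order.TTheory GRing.Theory Num.Theory.
Import numFieldNormedType.Exports.

Local Open Scope classical_set_scope.
Local Open Scope ring_scope.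

(* The library has no non-unital rings, so the multiplication of a *-algebra
   is a separate operation [x ** y]; no unit is assumed. *)
HB.mixin Record Lmodule_isStarAlgebra (K : numClosedFieldType) A
    & GRing.Lmodule K A := {
  smul : A -> A -> A;
  star : A -> A;
  smulA : associative smul;
  smulDl : left_distributive smul +%R;
  smulDr : right_distributive smul +%R;
  smulZl : forall (c : K) x y, smul (c *: x) y = c *: smul x y;
  smulZr : forall (c : K) x y, smul x (c *: y) = c *: smul x y;
  starK : involutive star;
  starD : {morph star : x y / x + y};
  starZ : forall (c : K) x, star (c *: x) = c^* *: star x;
  starM : forall x y, star (smul x y) = smul (star y) (star x)
}.

#[short(type="starAlgType")]
HB.structure Definition StarAlgebra (K : numClosedFieldType) :=
  {A of GRing.Lmodule K A & Lmodule_isStarAlgebra K A}.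

Notation "x ** y" := (smul x y) (at level 40, left associativity) : ring_scope.

(* Norms on [normedModType R[i]] take their values in the reals of [R[i]]. *)
HB.mixin Record StarAlgebra_isCStarAlgebra (R : realType) A
    & CompleteNormedModule R[i] A & StarAlgebra R[i] A := {
  norm_smul : forall x y : A, `|x ** y| <= `|x| * `|y|;
  norm_star_smul : forall x : A, `|star x ** x| = `|x| ^+ 2
}.

#[short(type="cstarAlgType")]
HB.structure Definition CStarAlgebra (R : realType) :=
  {A of CompleteNormedModule R[i] A & StarAlgebra R[i] A
      & StarAlgebra_isCStarAlgebra R A}.

Section star_algebra_notions.
Context {K : numClosedFieldType} {A : starAlgType K}.

Definition projection (p : A) := star p = p /\ p ** p = p.

Definition positive (a : A) := exists b : A, a = star b ** b.

Definition is_identity (u : A) := forall x : A, u ** x = x /\ x ** u = x.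

Lemma smulNl (x y : A) : (- x) ** y = - (x ** y).
Proof. by rewrite -scaleN1r smulZl scaleN1r. Qed.

Lemma smulNr (x y : A) : x ** (- y) = - (x ** y).
Proof. by rewrite -scaleN1r smulZr scaleN1r. Qed.

Lemma smulBl (x y z : A) : (x - y) ** z = x ** z - y ** z.
Proof. by rewrite smulDl smulNl. Qed.

Lemma smulBr (x y z : A) : x ** (y - z) = x ** y - x ** z.
Proof. by rewrite smulDr smulNr. Qed.

Lemma starN (x : A) : star (- x) = - star x.
Proof. by rewrite -scaleN1r starZ rmorphN rmorph1 scaleN1r. Qed.

Lemma starB (x y : A) : star (x - y) = star x - star y.
Proof. by rewrite starD starN. Qed.

End star_algebra_notions.

Section traces.
Context {R : realType} {A : cstarAlgType R}.
Local Notation C := (R[i]^o).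

(* [sup] is 0 on unbounded sets, so [functional_norm f = 1] forces [f] to be
   bounded. *)
Definition functional_norm (f : A -> C) : R :=
  sup [set complex.Re `|f a| | a in [set a : A | `|a| <= 1]].

Definition trace (tau : A -> C) :=
  [/\ linear tau,
      forall a, 0 <= tau (star a ** a),
      functional_norm tau = 1
    & forall a b, tau (a ** b) = tau (b ** a)].

Definition norm2 (X : set (A -> C)) (a : A) : R :=
  sup [set Num.sqrt (complex.Re (tau (star a ** a))) | tau in X].

Definition is_norm (N : A -> R) :=
  [/\ forall a, 0 <= N a,
      forall a b, N (a + b) <= N a + N b,
      forall (c : R[i]) a, N (c *: a) = complex.Re `|c| * N a
    & forall a, N a = 0 -> a = 0].

Definition unit_ball_complete (N : A -> R) :=
  forall u : nat -> A, (forall n, `|u n| <= 1) ->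
  (forall e : R, 0 < e -> exists n0 : nat, forall m n,
     (n0 <= m)%N -> (n0 <= n)%N -> N (u m - u n) < e) ->
  exists2 a : A, `|a| <= 1 & N (u n - a) @[n --> \oo] --> (0 : R).

(* The weak* topology on functionals is the topology [{ptws A -> C}] of
   pointwise convergence. *)
Record tracially_complete (X : set (A -> C)) : Prop := {
  tc_trace : X `<=` trace;
  tc_compact : compact (X : set {ptws A -> C});
  tc_convex : convex_set (X : set (convex_lmodType (A -> C)));
  tc_norm : is_norm (norm2 X);
  tc_complete : unit_ball_complete (norm2 X)
}.

Definition face (T F : set (A -> C)) :=
  [/\ F `<=` T,
      convex_set (F : set (convex_lmodType (A -> C)))
    & forall (x y : A -> C) (t : R[i]), T x -> T y -> 0 < t < 1 ->
        F (t *: x + (1 - t) *: y) -> F x /\ F y].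

Definition closed_face (T F : set (A -> C)) :=
  face T F /\ closure (F : set {ptws A -> C}) `&` T `<=` F.

Definition cstar_subalgebra (F : set A) :=
  [/\ F 0,
      forall (c : R[i]) x y, F x -> F y -> F (c *: x + y),
      forall x y, F x -> F y -> F (x ** y),
      forall x, F x -> F (star x)
    & closed F].

Definition finite_dimensional (F : set A) :=
  exists (n : nat) (e : 'I_n -> A),
    F = [set x | exists c : 'I_n -> R[i], x = \sum_(i < n) c i *: e i].

End traces.

Record tcAlgType (R : realType) := TCAlg {
  tc_sort :> cstarAlgType R;
  tc_traces : set (tc_sort -> R[i]^o);
  tc_ax : tracially_complete tc_traces
}.

Section tracially_complete_notions.
Context {R : realType} (M : tcAlgType R).
Local Notation X := (@tc_traces R M).

Definition tc_factorial := closed_face (@trace R M) X.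

Definition hyperfinite :=
  forall (S : set M) (e : R), finite_set S -> 0 < e ->
  exists F : set M, [/\ cstar_subalgebra F, finite_dimensional F
    & forall a, S a -> exists2 b, F b & norm2 X (a - b) < e].

Definition norm2_separable (S : set M) :=
  exists D : set M, [/\ countable D, D `<=` S
    & forall a (e : R), S a -> 0 < e ->
        exists2 d, D d & norm2 X (a - d) < e].

End tracially_complete_notions.

(* For filters on nat, empty intersection is equivalent to containing all
   cofinite sets. *)
Record free_filter := FreeFilter {
  ff_sets :> set_system nat;
  ff_proper : ProperFilter ff_sets;
  ff_free : \bigcap_(B in ff_sets) B = set0
}.
#[global] Existing Instance ff_proper.

Section bounded_sequences.
Context {R : realType} (M : cstarAlgType R).

Definition bounded_seq : pred (nat -> M) :=
  fun a => `[< exists K : R, forall n, `|a n| <= (K%:C)%C >].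

Lemma bounded_seqP a :
  reflect (exists K : R, forall n, `|a n| <= (K%:C)%C) (bounded_seq a).
Proof. exact: asboolP. Qed.

Lemma bounded_seq_submod : submod_closed bounded_seq.
Proof.
split=> [|c a b /bounded_seqP[K aK] /bounded_seqP[L bL]]; apply/bounded_seqP.
  by exists 0 => n; rewrite normr0.
exists (complex.Re `|c| * K + L) => n.
have -> : ((complex.Re `|c| * K + L)%:C)%C = `|c| * (K%:C)%C + (L%:C)%C.
  by rewrite rmorphD rmorphM.
by rewrite (le_trans (ler_normD _ _))// lerD// normrZ ler_wpM2l.
Qed.

HB.instance Definition _ :=
  GRing.isSubmodClosed.Build R[i] (nat -> M) bounded_seq bounded_seq_submod.

Record linf := Linf { linf_val :> nat -> M; linf_valP : bounded_seq linf_val }.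

HB.instance Definition _ := [isSub for linf_val].
HB.instance Definition _ := [Choice of linf by <:].
HB.instance Definition _ := [SubChoice_isSubLmodule of linf by <:].

End bounded_sequences.

Section linf_star.
Context {R : realType} {M : cstarAlgType R}.
Local Notation linf := (linf M).

Lemma cstar_norm_star (x : M) : `|star x| = `|x|.
Proof.
suff le_norm (y : M) : `|y| <= `|star y|.
  by apply: le_anti; rewrite -{2}(starK x) !le_norm.
have [->|y0] := eqVneq y 0; first by rewrite normr0.
by rewrite -(ler_pM2r (_ : 0 < `|y|)) ?normr_gt0// -expr2
  -norm_star_smul norm_smul.
Qed.

Lemma bounded_smul (a b : linf) : bounded_seq (fun n => a n ** b n).
Proof.
have /bounded_seqP[K aK] := linf_valP a.
have /bounded_seqP[L bL] := linf_valP b; apply/bounded_seqP.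
exists (K * L) => n; rewrite rmorphM (le_trans (norm_smul _ _))//.
exact: ler_pM.
Qed.

Lemma bounded_star (a : linf) : bounded_seq (fun n => star (a n)).
Proof.
have /bounded_seqP[K aK] := linf_valP a; apply/bounded_seqP.
by exists K => n; rewrite cstar_norm_star.
Qed.

Definition linf_smul (a b : linf) : linf := Linf (bounded_smul a b).
Definition linf_star (a : linf) : linf := Linf (bounded_star a).

Lemma linf_eq (a b : linf) : (forall n, a n = b n) -> a = b.
Proof. by move=> ab; apply: val_inj; apply/funext. Qed.

Fact linf_smulA : associative linf_smul.
Proof. by move=> a b c; apply: linf_eq => n; exact: smulA. Qed.
Fact linf_smulDl : left_distributive linf_smul +%R.
Proof. by move=> a b c; apply: linf_eq => n; exact: smulDl. Qed.
Fact linf_smulDr : right_distributive linf_smul +%R.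
Proof. by move=> a b c; apply: linf_eq => n; exact: smulDr. Qed.
Fact linf_smulZl (c : R[i]) a b : linf_smul (c *: a) b = c *: linf_smul a b.
Proof. by apply: linf_eq => n; exact: smulZl. Qed.
Fact linf_smulZr (c : R[i]) a b : linf_smul a (c *: b) = c *: linf_smul a b.
Proof. by apply: linf_eq => n; exact: smulZr. Qed.
Fact linf_starK : involutive linf_star.
Proof. by move=> a; apply: linf_eq => n; exact: starK. Qed.
Fact linf_starD : {morph linf_star : a b / a + b}.
Proof. by move=> a b; apply: linf_eq => n; exact: starD. Qed.
Fact linf_starZ (c : R[i]) a : linf_star (c *: a) = c^* *: linf_star a.
Proof. by apply: linf_eq => n; exact: starZ. Qed.
Fact linf_starM a b :
  linf_star (linf_smul a b) = linf_smul (linf_star b) (linf_star a).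
Proof. by apply: linf_eq => n; exact: starM. Qed.

HB.instance Definition _ := Lmodule_isStarAlgebra.Build R[i] linf
  linf_smulA linf_smulDl linf_smulDr linf_smulZl linf_smulZr
  linf_starK linf_starD linf_starZ linf_starM.

Lemma bounded_cst (a : M) : bounded_seq (fun=> a).
Proof.
apply/bounded_seqP; exists (complex.Re `|a|) => _.
by have := ger0_Im (normr_ge0 a); case: `|a| => r i /= ->.
Qed.

Definition linf_cst (a : M) : linf := Linf (bounded_cst a).

End linf_star.

Section trace_theory.
Context {R : realType} {A : cstarAlgType R}.
Local Notation C := (R[i]^o).

Section one_trace.
Variables (tau : A -> C) (tau_trace : trace tau).

Lemma traceD a b : tau (a + b) = tau a + tau b.
Proof.
by case: tau_trace => lin _ _ _; have := lin 1 a b; rewrite !scale1r.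
Qed.

Lemma trace0 : tau 0 = 0.
Proof. by apply: (addrI (tau 0)); rewrite -traceD !addr0. Qed.

Lemma traceZ (c : R[i]) a : tau (c *: a) = c * tau a.
Proof.
by case: tau_trace => lin _ _ _; have := lin c a 0; rewrite trace0 !addr0.
Qed.

Lemma trace_norm a : `|tau a| <= `|a|.
Proof.
have [->|a0] := eqVneq a 0; first by rewrite trace0 !normr0.
case: (tau_trace) => _ _ tau1 _.
pose B := [set complex.Re `|tau x| | x in [set x : A | `|x| <= 1]].
have supB : has_sup B.
  apply: contrapT => /sup_out; rewrite -/(functional_norm tau) tau1 => /eqP.
  by rewrite oner_eq0.
have normC (c : R[i]) : `|c| = ((complex.Re `|c|)%:C)%C.
  by have := ger0_Im (normr_ge0 c); case: `|c| => r i /= ->.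
have : complex.Re `|tau (`|a|^-1 *: a)| <= 1.
  rewrite -tau1; apply: (ub_le_sup supB.2); exists (`|a|^-1 *: a) => //=.
  by rewrite normrZ normfV normr_id mulVf// normr_eq0.
rewrite -lecR -normC traceZ normrM normfV normr_id mulrC.
by rewrite ler_pdivrMr ?normr_gt0// mul1r.
Qed.

End one_trace.
End trace_theory.

Section norm2_theory.
Context {R : realType} {A : cstarAlgType R}.
Local Notation C := (R[i]^o).

Lemma ge0_complex (c : R[i]) : 0 <= c -> c = ((complex.Re c)%:C)%C.
Proof. by move=> /ger0_Im; case: c => r i /= ->. Qed.

Lemma trace_positive (tau : A -> C) a : trace tau -> 0 <= tau (star a ** a).
Proof. by case. Qed.

Lemma trace_positive_Re (tau : A -> C) a : trace tau ->
  0 <= complex.Re (tau (star a ** a)).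
Proof. by move=> T; rewrite -lecR -ge0_complex// trace_positive. Qed.

Lemma trace_Re_le (tau : A -> C) a (K : R) : trace tau ->
  `|a| <= (K%:C)%C -> complex.Re (tau (star a ** a)) <= K ^+ 2.
Proof.
move=> T aK; have K0 := le_trans (normr_ge0 a) aK.
rewrite -lecR -ge0_complex ?trace_positive//.
rewrite -[leLHS]ger0_norm ?trace_positive// (le_trans (trace_norm T _))//.
by rewrite norm_star_smul rmorphXn lerXn2r ?nnegrE.
Qed.

Variables (X : set (A -> C)).
Hypothesis Xtrace : X `<=` trace.

Lemma norm2_ub tau a : X tau ->
  Num.sqrt (complex.Re (tau (star a ** a))) <= norm2 X a.
Proof.
move=> Xtau; apply: ub_le_sup; last by exists tau.
exists (complex.Re `|a|) => _ [sigma /Xtrace T <-].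
have a0 : 0 <= complex.Re `|a| by rewrite -lecR -ge0_complex// normr_ge0.
rewrite -(ger0_norm a0) -sqrtr_sqr ler_wsqrtr//.
by apply: trace_Re_le => //; rewrite -ge0_complex// normr_ge0.
Qed.

Lemma norm2_le a (B : R) : 0 <= B ->
  (forall tau, X tau -> Num.sqrt (complex.Re (tau (star a ** a))) <= B) ->
  norm2 X a <= B.
Proof.
move=> B0 aB; have [/set0P X0|/negP] := boolP (X != set0).
  apply: ge_sup; first by case: X0 => tau; exists (Num.sqrt (complex.Re (tau (star a ** a)))); exists tau.
  by move=> _ [tau /aB + <-].
by rewrite /norm2 => /negP; rewrite negbK => /eqP ->; rewrite image_set0 sup0.
Qed.

Lemma norm2_star a : norm2 X (star a) = norm2 X a.
Proof.
congr (sup _); apply: eq_imagel => tau /Xtrace[_ _ _ tauC].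
by rewrite starK tauC.
Qed.

Lemma norm2_smul a b (K L : R) : `|a| <= (K%:C)%C -> `|b| <= (L%:C)%C ->
  norm2 X (a ** b) <= Num.sqrt (norm2 X b * (K ^+ 2 * L + 1)).
Proof.
move=> aK bL.
have K0C := le_trans (normr_ge0 a) aK.
have K0 : 0 <= K by rewrite -lecR.
have L0 : 0 <= L by rewrite -lecR (le_trans (normr_ge0 b) bL).
set T := K ^+ 2 * L + 1.
have T1 : 0 < T by rewrite ltr_wpDl// mulr_ge0// exprn_ge0.
apply: norm2_le; first exact: sqrtr_ge0.
move=> tau Xtau; have Ttau := Xtrace Xtau; rewrite ler_wsqrtr//.
set Q := complex.Re _.
set P := complex.Re (tau (star b ** b)).
have Q0 : 0 <= Q by exact: trace_positive_Re.
have P0 : 0 <= P by exact: trace_positive_Re.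
suff QP : Q <= Num.sqrt P * T.
  by rewrite (le_trans QP)// ler_wpM2r ?(ltW T1)//; exact: norm2_ub.
pose h := star a ** a; pose w := h ** b.
have hE : star h = h by rewrite /h starM starK.
have wK : `|w| <= ((K ^+ 2 * L)%:C)%C.
  rewrite rmorphM rmorphXn (le_trans (norm_smul _ _))// ler_pM//.
  by rewrite /h norm_star_smul lerXn2r ?nnegrE.
have S2 : complex.Re (tau (star w ** w)) <= T ^+ 2.
  rewrite (le_trans (trace_Re_le Ttau wK))// lerXn2r ?nnegrE ?(ltW T1)//.
    by rewrite mulr_ge0// exprn_ge0.
  by rewrite lerDl.
have QE : tau (star b ** w) = tau (star (a ** b) ** (a ** b)).
  by rewrite /w /h starM !smulA.
have wb : star w ** b = star b ** w by rewrite /w starM hE !smulA.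
have quad (s : R) : 0 <= P - s * Q *+ 2 + s ^+ 2 * T ^+ 2.
  have := trace_positive_Re (b - (s%:C)%C *: w) Ttau.
  rewrite starB starZ.
  have -> : ((s%:C)%C)^* = (s%:C)%C :> R[i].
    by apply: conj_Creal; rewrite realE !lecR -realE num_real.
  rewrite smulBl !smulBr !smulZl !smulZr wb scalerA.
  have tN x : tau (- x) = - tau x.
    by rewrite -scaleN1r (traceZ Ttau) mulN1r.
  rewrite !(traceD Ttau, tN, traceZ Ttau) QE -rmorphM.
  have ReZ (r : R) (z : R[i]) : complex.Re ((r%:C)%C * z) = r * complex.Re z.
    by case: z => x y /=; rewrite mul0r subr0.
  have ReB (x y : R[i]) : complex.Re (x - y) = complex.Re x - complex.Re y.
    by case: x y => [? ?] [? ?].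
  rewrite !ReB !ReZ -/P -/Q => h0; apply: (le_trans h0).
  have := ler_wpM2l (sqr_ge0 s) S2.
  rewrite -expr2; lra.
have T0 : T != 0 by rewrite gt_eqF.
have := quad (Q / T ^+ 2).
have -> : P - Q / T ^+ 2 * Q *+ 2 + (Q / T ^+ 2) ^+ 2 * T ^+ 2 =
  P - Q ^+ 2 / T ^+ 2 by field.
rewrite subr_ge0 ler_pdivrMr ?exprn_gt0// => QPT.
rewrite -(ger0_norm Q0) -sqrtr_sqr -[X in _ * X](ger0_norm (ltW T1)).
by rewrite -(sqrtr_sqr T) -sqrtrM// ler_wsqrtr.
Qed.

End norm2_theory.

Section null_ideal.
Context {R : realType} (M : tcAlgType R) (w : free_filter).
Local Notation X := (@tc_traces R M).
Local Notation N := (norm2 X).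

Definition null_seq : pred (linf M) :=
  fun a => `[< N (a n) @[n --> ff_sets w] --> (0 : R) >].

Lemma null_seqP (a : linf M) :
  reflect (N (a n) @[n --> ff_sets w] --> (0 : R)) (null_seq a).
Proof. exact: asboolP. Qed.

Let N_norm : is_norm N := tc_norm (tc_ax M).
Let Xtrace : X `<=` trace := tc_trace (tc_ax M).

Lemma null_seqZ (c : R[i]) a : null_seq a -> null_seq (c *: a).
Proof.
case: N_norm => _ _ NZ _ /null_seqP a0; apply/null_seqP.
under eq_fun do rewrite NZ.
rewrite -(mulr0 (complex.Re `|c|)).
by apply: cvgM a0; exact: cvg_cst.
Qed.

Lemma null_seqD a b : null_seq a -> null_seq b -> null_seq (a + b).
Proof.
case: N_norm => N0 ND _ _ /null_seqP a0 /null_seqP b0; apply/null_seqP.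
apply: (@squeeze_cvgr _ _ _ _ (cst 0) (fun n => N (a n) + N (b n))).
- by apply: nearW => n; rewrite N0 ND.
- exact: cvg_cst.
- by rewrite -(addr0 0); exact: cvgD.
Qed.

Lemma null_seq_zmod : zmod_closed null_seq.
Proof.
split=> [|a b a0 b0].
  case: N_norm => _ _ NZ _; apply/null_seqP.
  have N00 : N 0 = 0 by rewrite -(scale0r (0 : M)) NZ normr0 mul0r.
  by under eq_fun do rewrite N00; exact: cvg_cst.
by apply: null_seqD => //; rewrite -scaleN1r null_seqZ.
Qed.

Lemma null_seq_star a : null_seq a -> null_seq (star a).
Proof.
move=> /null_seqP a0; apply/null_seqP.
by under eq_fun do rewrite norm2_star//.
Qed.

Lemma null_seq_smull a b : null_seq b -> null_seq (a ** b).
Proof.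
case: N_norm => N0 _ _ _ /null_seqP b0; apply/null_seqP.
have /bounded_seqP[K aK] := linf_valP a.
have /bounded_seqP[L bL] := linf_valP b.
apply: (@squeeze_cvgr _ _ _ _ (cst 0)
  (fun n => Num.sqrt (N (b n) * (K ^+ 2 * L + 1)))).
- by apply: nearW => n; rewrite N0 /= norm2_smul.
- exact: cvg_cst.
- rewrite -(sqrtr0 R) -(mul0r (K ^+ 2 * L + 1)).
  apply: (cvg_comp _ _ (cvgM b0 (cvg_cst _))).
  exact: sqrt_continuous.
Qed.

Lemma null_seq_smulr a b : null_seq a -> null_seq (a ** b).
Proof.
by move=> a0; rewrite -(starK (a ** b)) null_seq_star// starM
  null_seq_smull// null_seq_star.
Qed.

HB.instance Definition _ := GRing.isZmodClosed.Build (linf M) null_seq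
  null_seq_zmod.

End null_ideal.

Arguments null_seq {R} M w _.

Section reduced_power.
Context {R : realType} (M : tcAlgType R) (w : free_filter).

Definition null_ideal : zmodClosed (linf M) :=
  GRing.ZmodClosed.clone _ (null_seq M w) _.

Definition redpow : Type := Quotient.quot null_ideal.

HB.instance Definition _ := Choice.on redpow.
HB.instance Definition _ := EqQuotient.on redpow.
HB.instance Definition _ := GRing.Zmodule.on redpow.

(* The image in the reduced power of a bounded sequence; the operations of
   [redpow] are those induced by this surjection. *)
Definition redpow_class (a : linf M) : redpow := \pi_redpow%qT a.
Definition redpow_repr (x : redpow) : linf M := repr x.

Local Notation cl := redpow_class.
Local Notation rp := redpow_repr.

Lemma redpow_reprK x : cl (rp x) = x.
Proof. exact: reprK. Qed.

Lemma redpow_classP a b : cl a = cl b <-> null_seq M w (a - b).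
Proof. by rewrite -[null_seq M w (a - b)]/((a - b) \in null_ideal) Quotient.idealrBE;
  split=> /eqP. Qed.

Lemma redpow_classD a b : cl (a + b) = cl a + cl b.
Proof. exact: Quotient.pi_add. Qed.

Lemma null_redpow_repr a : null_seq M w (rp (cl a) - a).
Proof. by apply/redpow_classP; rewrite redpow_reprK. Qed.

Definition redpow_scale (c : R[i]) (x : redpow) : redpow := cl (c *: rp x).
Definition redpow_smul (x y : redpow) : redpow := cl (rp x ** rp y).
Definition redpow_star (x : redpow) : redpow := cl (star (rp x)).

Lemma redpow_classZ c a : cl (c *: a) = redpow_scale c (cl a).
Proof.
apply/redpow_classP; rewrite -scalerBr null_seqZ//.
by rewrite -opprB -scaleN1r null_seqZ// null_redpow_repr.
Qed.

Lemma redpow_class_smul a b : cl (a ** b) = redpow_smul (cl a) (cl b).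
Proof.
apply/esym/redpow_classP.
rewrite -(subrKA (rp (cl a) ** b)) -smulBr -smulBl.
by apply: null_seqD;
  [apply: null_seq_smull|apply: null_seq_smulr]; exact: null_redpow_repr.
Qed.

Lemma redpow_class_star a : cl (star a) = redpow_star (cl a).
Proof.
by apply/esym/redpow_classP; rewrite -starB null_seq_star// null_redpow_repr.
Qed.

Fact redpow_scaleA c d x :
  redpow_scale c (redpow_scale d x) = redpow_scale (c * d) x.
Proof. by rewrite -(redpow_reprK x) -!redpow_classZ scalerA. Qed.
Fact redpow_scale1 : left_id 1 redpow_scale.
Proof. by move=> x; rewrite -(redpow_reprK x) -redpow_classZ scale1r. Qed.
Fact redpow_scaleDr : right_distributive redpow_scale +%R.
Proof.
move=> c x y; rewrite -(redpow_reprK x) -(redpow_reprK y).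
by rewrite -!redpow_classZ -!redpow_classD -redpow_classZ scalerDr.
Qed.
Fact redpow_scaleDl x : {morph redpow_scale^~ x : c d / c + d}.
Proof.
move=> c d; rewrite -(redpow_reprK x).
by rewrite -!redpow_classZ -redpow_classD scalerDl.
Qed.

HB.instance Definition _ := GRing.Zmodule_isLmodule.Build R[i] redpow
  redpow_scaleA redpow_scale1 redpow_scaleDr redpow_scaleDl.

Lemma redpow_class_scale c a : cl (c *: a) = c *: cl a.
Proof. exact: redpow_classZ. Qed.

Fact redpow_smulA : associative redpow_smul.
Proof.
move=> x y z; rewrite -(redpow_reprK x) -(redpow_reprK y) -(redpow_reprK z).
by rewrite -!redpow_class_smul smulA.
Qed.
Fact redpow_smulDl : left_distributive redpow_smul +%R.
Proof.
move=> x y z; rewrite -(redpow_reprK x) -(redpow_reprK y) -(redpow_reprK z).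
by rewrite -redpow_classD -!redpow_class_smul -redpow_classD smulDl.
Qed.
Fact redpow_smulDr : right_distributive redpow_smul +%R.
Proof.
move=> x y z; rewrite -(redpow_reprK x) -(redpow_reprK y) -(redpow_reprK z).
by rewrite -redpow_classD -!redpow_class_smul -redpow_classD smulDr.
Qed.
Fact redpow_smulZl (c : R[i]) (x y : redpow) :
  redpow_smul (c *: x) y = c *: redpow_smul x y.
Proof.
rewrite -(redpow_reprK x) -(redpow_reprK y) -redpow_class_smul.
by rewrite -!redpow_class_scale -redpow_class_smul smulZl.
Qed.
Fact redpow_smulZr (c : R[i]) (x y : redpow) :
  redpow_smul x (c *: y) = c *: redpow_smul x y.
Proof.
rewrite -(redpow_reprK x) -(redpow_reprK y) -redpow_class_smul.
by rewrite -!redpow_class_scale -redpow_class_smul smulZr.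
Qed.
Fact redpow_starK : involutive redpow_star.
Proof.
by move=> x; rewrite -(redpow_reprK x) -!redpow_class_star starK.
Qed.
Fact redpow_starD : {morph redpow_star : x y / x + y}.
Proof.
move=> x y; rewrite -(redpow_reprK x) -(redpow_reprK y).
by rewrite -redpow_classD -!redpow_class_star -redpow_classD starD.
Qed.
Fact redpow_starZ (c : R[i]) (x : redpow) :
  redpow_star (c *: x) = c^* *: redpow_star x.
Proof.
rewrite -(redpow_reprK x) -redpow_class_star.
by rewrite -!redpow_class_scale -redpow_class_star starZ.
Qed.
Fact redpow_starM x y :
  redpow_star (redpow_smul x y) = redpow_smul (redpow_star y) (redpow_star x).
Proof.
rewrite -(redpow_reprK x) -(redpow_reprK y).
by rewrite -redpow_class_smul -!redpow_class_star -redpow_class_smul starM.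
Qed.

HB.instance Definition _ := Lmodule_isStarAlgebra.Build R[i] redpow
  redpow_smulA redpow_smulDl redpow_smulDr redpow_smulZl redpow_smulZr
  redpow_starK redpow_starD redpow_starZ redpow_starM.

Definition redpow_cst (a : M) : redpow := redpow_class (linf_cst a).

Definition limit_traces : set (redpow -> R[i]^o) :=
  [set phi | exists (tau : nat -> M -> R[i]^o) (u : set_system nat),
    [/\ forall n, tc_traces (tau n), UltraFilter u, ff_sets w `<=` u
      & forall a : linf M,
          tau n (a n) @[n --> u] --> phi (redpow_class a)]].

(* The closed convex hull is taken in the space of all functions on [redpow];
   it is made of tracial states, as these are stable under convex combinations
   and pointwise limits ([redpow] being unital, the norm of a positive
   functional is its value at the unit). *)
Definition redpow_traces : set (redpow -> R[i]^o) :=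
  [set phi | forall Y : set (redpow -> R[i]^o),
    closed (Y : set {ptws redpow -> R[i]^o}) ->
    convex_set (Y : set (convex_lmodType (redpow -> R[i]^o))) ->
    limit_traces `<=` Y -> Y phi].

(* Families are indexed by ['I_k.+1] so that the minimum is over a nonempty
   set; the base value [a ord0] of the iterated minimum is one of its terms. *)
Definition CPoU :=
  forall (S : set M) (k : nat) (a : 'I_k.+1 -> M) (delta : R),
  norm2_separable S ->
  (forall i, positive (a i)) ->
  sup [set \big[Order.min/complex.Re (tau (a ord0))]_(i < k.+1)
             complex.Re (tau (a i)) | tau in @tc_traces R M] < delta ->
  exists p : 'I_k.+1 -> redpow,
    [/\ forall i, projection (p i),
        forall i s, S s -> p i ** redpow_cst s = redpow_cst s ** p i,
        forall i j, i != j -> p i ** p j = 0,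
        is_identity (\sum_(i < k.+1) p i)
      & forall tau i, redpow_traces tau ->
          tau (redpow_cst (a i) ** p i) <= (delta%:C)%C * tau (p i)].

End reduced_power.

(* Main.v *)
(* Let X be the set of traces, N the norm [norm2 X] and F a finite-dimensional
   subalgebra containing, up to a small error in N, a finite part of S and the
   elements [a i].  The orthogonal complement of the commutators of F for a
   faithful tracial functional is the centre of F, so every self-adjoint c in F
   has a central w with the same values on all traces, and a spectral
   projection of w splits F into a part where c is nonpositive on all traces
   and a part where it is nonnegative.  Applied successively to [a i - delta],
   this gives orthogonal almost central projections [p i] with
   tau(a_i p_i) <= delta tau(p_i), and a remainder q with
   tau(a_i q) >= delta tau(q) for all i.
   The remainder is small in N if F is good enough: otherwise a limit of the
   functionals tau(q .) along an ultrafilter is a positive tracial functional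
   dominated by a trace of X; as X is a face, normalising it gives a trace of X
   which is at least delta on every [a i], against the choice of delta.
   That M has a unit is part of what has to be proved. The units e of
   the subalgebras F satisfy N(x - e x) -> 0, and products are norm dense in M,
   so tau(e) -> 1 pointwise on X; compactness makes this uniform, the units
   form a Cauchy net for N, and its limit is the unit of M. *)
Require Import Defs.
From mathcomp Require Import all_boot all_order all_algebra.
From mathcomp Require Import complex.
From mathcomp Require Import all_classical all_reals all_analysis.
From mathcomp Require Import ring lra.

Set Implicit Arguments.
Unset Strict Implicit.
Unset Printing Implicit Defensive.

Import Order.TTheory GRing.Theory Num.Theory.
Import numFieldNormedType.Exports.

Local Open Scope classical_set_scope.
Local Open Scope ring_scope.

(** * Complex numbers, norms and tracial functionals *)

Section complex_parts.
Context {R : realType}.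
Implicit Types z w : R[i].

Lemma ReD z w : complex.Re (z + w) = complex.Re z + complex.Re w.
Proof. by case: z w => [? ?] [? ?]. Qed.

Lemma ReN z : complex.Re (- z) = - complex.Re z.
Proof. by case: z. Qed.

Lemma ReB z w : complex.Re (z - w) = complex.Re z - complex.Re w.
Proof. by rewrite ReD ReN. Qed.

Lemma ReZ (r : R) z : complex.Re ((r%:C)%C * z) = r * complex.Re z.
Proof. by case: z => x y /=; rewrite mul0r subr0. Qed.

Lemma Re_iM z : complex.Re (('i)%C * z) = - complex.Im z.
Proof. by case: z => x y /=; rewrite mul0r mul1r add0r. Qed.

Lemma conjcR (r : R) : ((r%:C)%C)^* = (r%:C)%C :> R[i].
Proof. by apply/eqP; rewrite eq_complex /= oppr0 !eqxx. Qed.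

Lemma conjci : (('i)%C)^* = - ('i)%C :> R[i].
Proof. by apply/eqP; rewrite eq_complex /= oppr0 !eqxx. Qed.

Lemma normC_Re z : `|z| = ((complex.Re `|z|)%:C)%C.
Proof. exact: ge0_complex. Qed.

Lemma Re_ge0 z : 0 <= z -> 0 <= complex.Re z.
Proof. by move=> z0; rewrite -lecR -ge0_complex. Qed.

Lemma ler_Re z w : z <= w -> complex.Re z <= complex.Re w.
Proof. by rewrite lecE => /andP[]. Qed.

Lemma Re_le_norm z : complex.Re z <= complex.Re `|z|.
Proof.
rewrite (le_trans (ler_norm _))// -lecR -normC_Re; exact: normc_ge_Re.
Qed.

(** Multiplying the argument of a linear functional by such a [c] turns a modulus into a real part,
    so that suprema of moduli can be handled with real parts. *)
Lemma rotate_to_norm z : exists2 c : R[i], `|c| = 1 & c * z = `|z|.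
Proof.
have [->|z0] := eqVneq z 0; first by exists 1; rewrite ?normr1// mul1r normr0.
have n0 : `|z| != 0 by rewrite normr_eq0.
exists (`|z| / z); first by rewrite normrM normfV normr_id divff.
by rewrite -mulrA mulVf// mulr1.
Qed.

Lemma half_double z : ((2^-1)%:C)%C * (z + z) = z.
Proof.
case: z => x y; apply/eqP; rewrite eq_complex /=.
by apply/andP; split; apply/eqP; field.
Qed.

Lemma conj_mul_Re z (r : R) :
  complex.Re (z^* * (z * (r%:C)%C)) = complex.Re (z^* * z) * r.
Proof. by case: z => x y /=; ring. Qed.

Lemma conj_mul_eq0 z : complex.Re (z^* * z) = 0 -> z = 0.
Proof.
case: z => x y /= h; apply/eqP; rewrite eq_complex /=.
have := sqr_ge0 x; have := sqr_ge0 y => hx hy.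
by rewrite -(sqrf_eq0 x) -(sqrf_eq0 y); apply/andP; split; apply/eqP; lra.
Qed.

End complex_parts.

(** Norms have their values in [R[i]]; this copy takes values in [R], where the estimates are
    carried out. *)
Definition rnorm {R : realType} {A : cstarAlgType R} (a : A) : R :=
  complex.Re `|a|.

Section rnorm_theory.
Context {R : realType} {A : cstarAlgType R}.
Implicit Types a b : A.

Lemma normE a : `|a| = ((rnorm a)%:C)%C.
Proof. exact: ge0_complex. Qed.

Lemma rnorm_ge0 a : 0 <= rnorm a.
Proof. exact: Re_ge0. Qed.

Lemma ler_rnormD a b : rnorm (a + b) <= rnorm a + rnorm b.
Proof. by rewrite -lecR rmorphD /= -!normE ler_normD. Qed.

Lemma rnormM a b : rnorm (a ** b) <= rnorm a * rnorm b.
Proof. by rewrite -lecR rmorphM /= -!normE norm_smul. Qed.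

Lemma rnorm_star a : rnorm (star a) = rnorm a.
Proof. by rewrite /rnorm cstar_norm_star. Qed.

Lemma rnorm_starM a : rnorm (star a ** a) = rnorm a ^+ 2.
Proof. by apply: (@complexI R); rewrite rmorphXn /= -!normE norm_star_smul. Qed.

Lemma rnormZ (c : R[i]) a : rnorm (c *: a) = complex.Re `|c| * rnorm a.
Proof. by apply: (@complexI R); rewrite rmorphM /= -!normE normrZ -normC_Re. Qed.

Lemma rnormZr (r : R) a : rnorm ((r%:C)%C *: a) = `|r| * rnorm a.
Proof. by rewrite rnormZ normc_def /= expr0n addr0 sqrtr_sqr. Qed.

Lemma rnormN a : rnorm (- a) = rnorm a.
Proof. by rewrite /rnorm normrN. Qed.

Lemma ler_rnormB a b : rnorm (a - b) <= rnorm a + rnorm b.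
Proof. by rewrite (le_trans (ler_rnormD _ _))// rnormN. Qed.

Lemma rnorm0 : rnorm (0 : A) = 0.
Proof. by rewrite /rnorm normr0. Qed.

Lemma rnorm0_eq0 a : rnorm a = 0 -> a = 0.
Proof. by move=> a0; apply/eqP; rewrite -normr_eq0 normE a0. Qed.

Lemma star0 : star (0 : A) = 0.
Proof. by apply: (addrI (star 0)); rewrite -starD !addr0. Qed.

Lemma smul0l a : 0 ** a = 0.
Proof. by apply: (addrI (0 ** a)); rewrite -smulDl !addr0. Qed.

Lemma smul0r a : a ** 0 = 0.
Proof. by apply: (addrI (a ** 0)); rewrite -smulDr !addr0. Qed.

Lemma star_sum I (r : seq I) (P : pred I) (F : I -> A) :
  star (\sum_(i <- r | P i) F i) = \sum_(i <- r | P i) star (F i).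
Proof. exact: (big_morph _ (@starD _ _) star0). Qed.

Lemma smul_suml I (r : seq I) (P : pred I) (F : I -> A) a :
  (\sum_(i <- r | P i) F i) ** a = \sum_(i <- r | P i) F i ** a.
Proof. by rewrite (big_morph (fun x => x ** a) (fun x y => smulDl x y a) (smul0l a)). Qed.

Lemma smul_sumr I (r : seq I) (P : pred I) (F : I -> A) a :
  a ** (\sum_(i <- r | P i) F i) = \sum_(i <- r | P i) a ** F i.
Proof. by rewrite (big_morph (fun x => a ** x) (smulDr a) (smul0r a)). Qed.

Lemma cstar_eq0 a : star a ** a = 0 -> a = 0.
Proof.
move=> a0; apply: rnorm0_eq0; apply/eqP; rewrite -sqrf_eq0 -rnorm_starM a0.
by rewrite rnorm0.
Qed.

Lemma rnorm_projection a : projection a -> rnorm a <= 1.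
Proof.
move=> [sa aa]; have := rnorm_starM a; rewrite sa aa => h.
have := rnorm_ge0 a; nra.
Qed.

End rnorm_theory.

Section tracial_functionals.
Context {R : realType} {A : cstarAlgType R}.
Local Notation C := (R[i]^o).

(** Traces without the normalisation: sums and limits of traces are formed first, and a norm is
    fixed only at the end. *)
Record tracial_functional (f : A -> C) : Prop := {
  tf_linear : linear f;
  tf_pos : forall a, 0 <= f (star a ** a);
  tf_comm : forall a b, f (a ** b) = f (b ** a)
}.

Lemma trace_tracial f : trace f -> tracial_functional f.
Proof. by case. Qed.

Section linear_functional.
Variables (f : A -> C) (flin : linear f).

Lemma tfD a b : f (a + b) = f a + f b.
Proof. by have := flin 1 a b; rewrite !scale1r. Qed.

Lemma tf0 : f 0 = 0.
Proof. by apply: (addrI (f 0)); rewrite -tfD !addr0. Qed.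

Lemma tfZ (c : R[i]) a : f (c *: a) = c * f a.
Proof. by have := flin c a 0; rewrite tf0 !addr0. Qed.

Lemma tfN a : f (- a) = - f a.
Proof. by rewrite -scaleN1r tfZ mulN1r. Qed.

Lemma tfB a b : f (a - b) = f a - f b.
Proof. by rewrite tfD tfN. Qed.

Lemma tf_sum I (r : seq I) (P : pred I) (F : I -> A) :
  f (\sum_(i <- r | P i) F i) = \sum_(i <- r | P i) f (F i).
Proof. exact: (big_morph _ tfD tf0). Qed.

End linear_functional.

Lemma tfD_tracial f g : tracial_functional f -> tracial_functional g ->
  tracial_functional (fun a => f a + g a).
Proof.
move=> F G; split=> [c a b|a|a b].
- by rewrite (tf_linear F) (tf_linear G) scalerDr addrACA.
- by rewrite addr_ge0// tf_pos.
- by rewrite (tf_comm F) (tf_comm G).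
Qed.

Section one_functional.
Variables (f : A -> C) (F : tracial_functional f).
Let flin := tf_linear F.

Definition rf a : R := complex.Re (f a).

Lemma rfD a b : rf (a + b) = rf a + rf b.
Proof. by rewrite /rf (tfD flin) ReD. Qed.

Lemma rfN a : rf (- a) = - rf a.
Proof. by rewrite /rf (tfN flin) ReN. Qed.

Lemma rfB a b : rf (a - b) = rf a - rf b.
Proof. by rewrite rfD rfN. Qed.

Lemma rfZ (r : R) a : rf ((r%:C)%C *: a) = r * rf a.
Proof. by rewrite /rf (tfZ flin) ReZ. Qed.

Lemma rf0 : rf 0 = 0.
Proof. by rewrite /rf (tf0 flin). Qed.

Lemma rf_sum I (r : seq I) (P : pred I) (G : I -> A) :
  rf (\sum_(i <- r | P i) G i) = \sum_(i <- r | P i) rf (G i).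
Proof. exact: (big_morph _ rfD rf0). Qed.

Lemma rf_comm a b : rf (a ** b) = rf (b ** a).
Proof. by rewrite /rf (tf_comm F). Qed.

Lemma rf_pos a : 0 <= rf (star a ** a).
Proof. exact/Re_ge0/tf_pos. Qed.

Lemma tf_square a : f (star a ** a) = ((rf (star a ** a))%:C)%C.
Proof. exact/ge0_complex/tf_pos. Qed.

(** The imaginary part of [f] vanishes on the square of [a + i b]; after expansion, what remains of
    it is the difference of the two sides. *)
Lemma rf_starC a b : rf (star a ** b) = rf (star b ** a).
Proof.
have /ger0_Im := tf_pos F (a + ('i)%C *: b).
rewrite starD starZ conjci smulDl !smulDr !smulZl !smulZr !scaleNr.
rewrite !(tfD flin) !(tfN flin) !(tfZ flin).
rewrite (tf_square a) (tf_square b) /rf.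
case: (f (star a ** b)) => p q; case: (f (star b ** a)) => s t /=; lra.
Qed.

Lemma rf_cauchy_schwarz a b :
  rf (star a ** b) ^+ 2 <= rf (star a ** a) * rf (star b ** b).
Proof.
have quad (t : R) : 0 <= rf (star a ** a) + 2 * t * rf (star a ** b)
    + t ^+ 2 * rf (star b ** b).
  have := rf_pos (a + (t%:C)%C *: b).
  rewrite starD starZ conjcR smulDl !smulDr !smulZl !smulZr !(rfD, rfZ).
  rewrite (rf_starC b a); lra.
set p := rf _ in quad *; set q := rf (star b ** b) in quad *.
set r := rf _ in quad *.
have q0 : 0 <= q by exact: rf_pos.
move: q0; rewrite le_eqVlt => /predU1P[q0|q0].
- have [r0|r0] := eqVneq r 0; first by rewrite r0 -q0 mulr0 expr0n.
  (* The quadratic has degenerated to an affine function of [t], and this [t] gives it the value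
     [-1]. *)
  have := quad (- (p + 1) / (2 * r)).
  rewrite -q0 mulr0 addr0.
  have -> : 2 * (- (p + 1) / (2 * r)) * r = - (p + 1) by field.
  by lra.
- have := quad (- r / q).
  have -> : p + 2 * (- r / q) * r + (- r / q) ^+ 2 * q = (p * q - r ^+ 2) / q.
    by field; rewrite gt_eqF.
  by rewrite pmulr_lge0 ?invr_gt0// subr_ge0.
Qed.

(** The difference of the two sides is the value of [rf] at the square of [a - p a]. *)
Lemma rf_projection_le p a : projection p ->
  rf (star (p ** a) ** (p ** a)) <= rf (star a ** a).
Proof.
move=> [sp pp]; have := rf_pos (a - p ** a).
have e : star (p ** a) ** (p ** a) = star a ** (p ** a).
  by rewrite starM sp -!smulA (smulA p p) pp.
rewrite starB smulBl !smulBr !rfB e.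
by rewrite (_ : star (p ** a) ** a = star a ** (p ** a)) 1?starM ?sp ?smulA//; lra.
Qed.

End one_functional.
End tracial_functionals.

(** * Finite-dimensional subalgebras *)

Section spans.
Context {R : realType} {A : cstarAlgType R}.
Local Notation C := (R[i]^o).
Implicit Types f g : A -> C.

Definition spanned n (v : 'I_n -> A) : set A :=
  [set x | exists c : 'I_n -> R[i], x = \sum_(i < n) c i *: v i].

Lemma spanned_lin n (v : 'I_n -> A) (c : R[i]) x y :
  spanned v x -> spanned v y -> spanned v (c *: x + y).
Proof.
move=> [a ->] [b ->]; exists (fun i => c * a i + b i).
rewrite scaler_sumr -big_split; apply: eq_bigr => i _.
by rewrite scalerA scalerDl.
Qed.

Lemma spanned0 n (v : 'I_n -> A) : spanned v 0.
Proof. by exists (fun=> 0); rewrite big1// => i _; rewrite scale0r. Qed.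

Lemma spanned_sum n (v : 'I_n -> A) I (r : seq I) (c : I -> R[i]) (x : I -> A) :
  (forall i, spanned v (x i)) -> spanned v (\sum_(i <- r) c i *: x i).
Proof.
move=> vx; apply: (big_ind (spanned v)); first exact: spanned0.
- by move=> a b va vb; rewrite -(scale1r a); exact: spanned_lin.
- move=> i _; rewrite -[_ *: _]addr0.
  by apply: spanned_lin => //; exact: spanned0.
Qed.

Lemma spanned_gen n (v : 'I_n -> A) i : spanned v (v i).
Proof.
exists (fun j => (j == i)%:R); rewrite (bigD1 i)//= eqxx scale1r big1 ?addr0//.
by move=> j /negPf ->; rewrite scale0r.
Qed.

Definition faithful_on (V : set A) (f : A -> C) :=
  forall x, V x -> rf f (star x ** x) = 0 -> x = 0.

Definition separated_by_traces := forall x : A,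
  (forall f, tracial_functional f -> rf f (star x ** x) = 0) -> x = 0.

Lemma rf_null f x : tracial_functional f -> rf f (star x ** x) = 0 ->
  forall y, rf f (star y ** x) = 0.
Proof.
move=> F x0 y; have := rf_cauchy_schwarz F y x; rewrite x0 mulr0.
by move=> h; apply/eqP; rewrite -sqrf_eq0 eq_le h sqr_ge0.
Qed.

Lemma rf_nullZ f x (k : R[i]) : tracial_functional f ->
  rf f (star x ** x) = 0 -> rf f (star (k *: x) ** (k *: x)) = 0.
Proof.
move=> F x0; rewrite /rf starZ smulZl smulZr !(tfZ (tf_linear F)).
by rewrite (tf_square F) x0 !mulr0.
Qed.

(** Induction on the number of generators. If [f] is faithful on the smaller span but kills the
    square of some nonzero [x0] in the larger one, add a [g] that detects [x0]. A null vector of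
    [f + g] differs from a multiple of [x0] by an element of the smaller span, hence is such a
    multiple, and [g] forces it to be 0. *)
Lemma exists_faithful n (v : 'I_n -> A) : separated_by_traces ->
  exists2 f, tracial_functional f & faithful_on (spanned v) f.
Proof.
move=> sep; elim: n v => [|n IH] v.
  exists (fun=> 0); last by move=> x [c ->] _; rewrite big_ord0.
  by split=> // c a b; rewrite scaler0 addr0.
have [f F fV] := IH (fun i => v (widen_ord (leqnSn n) i)).
have [?|] := pselect (faithful_on (spanned v) f); first by exists f.
move=> /existsNP[x0 /not_implyP[[c0 x0E] /not_implyP[fx0 /eqP x0n0]]].
have [g [G gx0]] : exists g, tracial_functional g /\ rf g (star x0 ** x0) <> 0.
  apply: contrapT => /forallNP h; move/eqP: x0n0; apply; apply: sep => g G.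
  by apply: contrapT => gx; apply: (h g).
exists (fun a => f a + g a); first exact: tfD_tracial.
move=> y [c1 yE]; rewrite /rf ReD.
rewrite -[complex.Re (f _)]/(rf f _) -[complex.Re (g _)]/(rf g _) => fgy.
have [fy gy] : rf f (star y ** y) = 0 /\ rf g (star y ** y) = 0.
  have := rf_pos F y; have := rf_pos G y; lra.
have c00 : c0 ord_max != 0.
  apply: contraNneq x0n0 => c00; apply/eqP/fV => //.
  by rewrite x0E big_ord_recr /= c00 scale0r addr0; exists (c0 \o widen_ord (leqnSn n)).
pose k := c1 ord_max / c0 ord_max.
have zE : y - k *: x0 = 0.
  apply: fV.
    rewrite yE x0E scaler_sumr -sumrB.
    exists (fun i => c1 (widen_ord (leqnSn n) i) - k * c0 (widen_ord (leqnSn n) i)).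
    rewrite big_ord_recr /= [X in _ + X](_ : _ = 0) ?addr0.
      by apply: eq_bigr => i _; rewrite scalerBl scalerA.
    by rewrite scalerA /k divfK ?subrr.
  by rewrite smulBr (rfB F) (rf_null F fy) (rf_null F (rf_nullZ k F fx0)) subrr.
move/eqP: zE; rewrite subr_eq0 => /eqP yk.
have k0 : k = 0.
  move: gy; rewrite yk /rf starZ smulZl smulZr !(tfZ (tf_linear G)) (tf_square G).
  rewrite conj_mul_Re => /eqP; rewrite mulf_eq0 => /orP[/eqP/conj_mul_eq0//|/eqP//].
by rewrite yk k0 scale0r.
Qed.

(** The coefficients of [b] solve a linear system given by the Gram matrix of [v]. Since [v] may be
    linearly dependent, the matrix may be singular, and solvability is tested on its cokernel. *)
Lemma riesz n (v : 'I_n -> A) (f g : A -> C) :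
  tracial_functional f -> faithful_on (spanned v) f -> linear g ->
  exists2 b, spanned v b &
    forall x, spanned v x -> f (star x ** b) = g (star x).
Proof.
move=> F fV glin; have flin := tf_linear F.
pose G : 'M[R[i]]_n := \matrix_(j, i) f (star (v i) ** v j).
pose h : 'rV[R[i]]_n := \row_i g (star (v i)).
have : (h <= G)%MS.
  rewrite submxE; apply/eqP/rowP => l; rewrite !mxE.
  pose u i := cokermx G i l.
  have Gu k : \sum_i u i * f (star (v i) ** v k) = 0.
    have /matrixP/(_ k l) := mulmx_coker G; rewrite !mxE => Gl; rewrite -[RHS]Gl.
    by apply: eq_bigr => i _; rewrite [G _ _]mxE mulrC.
  (* A column of the cokernel yields a null vector [x] of [f]; faithfulness makes it 0, so the
     right-hand side of the system is annihilated as well. *)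
  pose x := \sum_i (u i)^* *: v i.
  have sxE : star x = \sum_i u i *: star (v i).
    by rewrite star_sum; apply: eq_bigr => i _; rewrite starZ conjCK.
  have x0 : x = 0.
    apply: fV; first by exists (fun i => (u i)^*).
    rewrite {2}/x smul_sumr /rf (tf_sum flin) big1// => k _.
    rewrite smulZr (tfZ flin) sxE smul_suml (tf_sum flin).
    under eq_bigr do rewrite smulZl (tfZ flin).
    by rewrite Gu mulr0.
  transitivity (g (star x)); last by rewrite x0 star0 (tf0 glin).
  rewrite sxE (tf_sum glin); apply: eq_bigr => i _.
  by rewrite (tfZ glin) [h _ _]mxE mulrC.
move=> /submxP[D hD]; exists (\sum_j D 0 j *: v j); first by exists (D 0).
move=> _ [c ->]; rewrite star_sum smul_suml (tf_sum flin) (tf_sum glin).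
apply: eq_bigr => i _; rewrite starZ smulZl (tfZ flin) (tfZ glin); congr (_ * _).
have /rowP/(_ i) := hD; rewrite !mxE => ->.
rewrite smul_sumr (tf_sum flin); apply: eq_bigr => j _.
by rewrite smulZr (tfZ flin) !mxE.
Qed.

End spans.

(** * Unit, centre and spectral projections of a finite-dimensional subalgebra *)

Section finite_dimensional_algebra.
Context {R : realType} {A : cstarAlgType R}.
Local Notation C := (R[i]^o).
Variables (F : set A) (n : nat) (v : 'I_n -> A).
Hypotheses (Falg : cstar_subalgebra F) (Fv : F = spanned v).
Hypothesis sep : separated_by_traces (A := A).

Let F0 : F 0. Proof. by case: Falg. Qed.
Let Flin (c : R[i]) x y : F x -> F y -> F (c *: x + y).
Proof. by case: Falg => _ + _ _ _; apply. Qed.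
Let FM x y : F x -> F y -> F (x ** y).
Proof. by case: Falg => _ _ + _ _; apply. Qed.
Let Fstar x : F x -> F (star x).
Proof. by case: Falg => _ _ _ + _; apply. Qed.
Let FZ (c : R[i]) x : F x -> F (c *: x).
Proof. by move=> Fx; rewrite -[_ *: _]addr0; exact: Flin. Qed.
Let FD x y : F x -> F y -> F (x + y).
Proof. by move=> Fx Fy; rewrite -[x]scale1r; exact: Flin. Qed.
Let FN x : F x -> F (- x).
Proof. by move=> Fx; rewrite -scaleN1r; exact: FZ. Qed.
Let FB x y : F x -> F y -> F (x - y).
Proof. by move=> Fx Fy; apply: FD => //; exact: FN. Qed.

(** The unit is the vector [e] that represents [f] itself: then [f (star y (x e - x)) = 0] for all
    [y] in [F], and [f] is faithful on [F]. *)
Lemma subalgebra_unit :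
  exists2 e, F e /\ projection e & forall x, F x -> e ** x = x /\ x ** e = x.
Proof.
have [f ft] := exists_faithful v sep; rewrite -Fv => ff.
have := riesz ft (_ : faithful_on (spanned v) f) (tf_linear ft).
rewrite -Fv => /(_ ff)[e Fe eE].
have xe x : F x -> x ** e = x.
  move=> Fx; apply/eqP; rewrite -subr_eq0; apply/eqP/ff.
    by apply: FB => //; exact: FM.
  set d := _ - x; have Fd : F d by apply: FB => //; exact: FM.
  rewrite {2}/d smulBr (rfB ft) smulA /rf.
  rewrite -{1}(starK (star d ** x)) eE ?subrr ?starK ?subrr//.
  by apply/Fstar/FM => //; exact: Fstar.
have ee : star e = e.
  by have h := xe _ (Fstar Fe); have := congr1 star h; rewrite starM starK h.
exists e; first by split=> //; split=> //; exact: xe.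
move=> x Fx; split; last exact: xe.
by rewrite -(starK (e ** x)) starM ee xe ?starK//; exact: Fstar.
Qed.

Definition tracial_on (V : set A) (g : A -> C) :=
  forall x y, V x -> V y -> g (x ** y) = g (y ** x).

Definition central_in (V : set A) (w : A) := forall y, V y -> w ** y = y ** w.

(** Let [b] be the orthogonal projection of [c] onto the span of the commutators. Then [c - b] is
    central, and functionals tracial on [F] vanish on [b] and on its adjoint, so the self-adjoint
    part of [c - b] serves as [w]. *)
Lemma central_representative c : F c -> star c = c ->
  exists w, [/\ F w, star w = w, central_in F w
    & forall g, linear g -> tracial_on F g -> g c = g w].
Proof.
move=> Fc sc; have [f ft] := exists_faithful v sep; rewrite -Fv => ff.
have flin := tf_linear ft.
pose I := ('I_n * 'I_n)%type.
pose com (ij : I) := v ij.1 ** v ij.2 - v ij.2 ** v ij.1.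
pose u (k : 'I_#|{: I}|) := com (enum_val k).
have Fvi i : F (v i) by rewrite Fv; exact: spanned_gen.
have Fcom ij : F (com ij) by apply: FB; exact: FM.
have uF x : spanned u x -> F x.
  move=> [d ->]; apply: (big_ind F) => // i _; apply: FZ; exact: Fcom.
have ucom x y : F x -> F y -> spanned u (x ** y - y ** x).
  rewrite Fv => -[a ->] [b ->].
  rewrite smul_suml [X in _ - X]smul_sumr -sumrB.
  rewrite (eq_bigr (fun i => a i *: (\sum_(j < n) b j *: com (i, j)))); last first.
    move=> i _; rewrite smulZl smulZr -scalerBr; congr (_ *: _).
    rewrite smul_sumr smul_suml -sumrB; apply: eq_bigr => j _.
    by rewrite smulZl smulZr -scalerBr.
  apply: spanned_sum => i; apply: spanned_sum => j.
  by rewrite -[com _]/(com (i, j)) -(enum_rankK (i, j)); exact: spanned_gen.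
have kill g : linear g -> tracial_on F g -> forall x, spanned u x -> g x = 0.
  move=> gl gt _ [d ->]; rewrite (tf_sum gl) big1// => k _.
  by rewrite (tfZ gl) /u /com (tfB gl) gt ?subrr ?mulr0.
have [b ub bE] : exists2 b, spanned u b &
    forall x, spanned u x -> f (star x ** b) = f (star x ** c).
  have fc : linear (fun x => f (x ** c)).
    by move=> k x y; rewrite smulDl smulZl flin.
  by apply: (riesz ft _ fc) => x /uF; exact: ff.
have Fb := uF _ ub.
pose w0 := c - b; have Fw0 : F w0 by exact: FB.
(* By the trace property, orthogonality to commutators reads [f (x (y w0 - w0 y)) = 0]; for [x] the
   adjoint of the second factor, faithfulness applies. *)
have w0C y : F y -> y ** w0 = w0 ** y.
  move=> Fy; have orth x : F x -> f ((x ** y - y ** x) ** w0) = 0.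
    move=> Fx.
    have /bE : spanned u (star y ** star x - star x ** star y).
      by apply: ucom; exact: Fstar.
    rewrite starB !starM !starK => E.
    by rewrite /w0 smulBr (tfB flin) E subrr.
  apply/eqP; rewrite -subr_eq0; apply/eqP/ff; first by apply: FB; exact: FM.
  set d := _ - w0 ** y; have Fd : F d by apply: FB; exact: FM.
  have := orth (star d) (Fstar Fd).
  rewrite smulBl (tfB flin) -(smulA y) (tf_comm ft y) -!smulA -(tfB flin) -smulBr.
  by rewrite /rf -/d => ->.
pose w := ((2^-1)%:C)%C *: (w0 + star w0).
have Fw : F w by apply/FZ/FD => //; exact: Fstar.
exists w; split=> // [|y Fy|g gl gt].
- by rewrite starZ conjcR starD starK addrC.
- rewrite smulZl smulZr smulDl smulDr -w0C//; congr (_ *: (_ + _)).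
  by rewrite -{1}(starK y) -starM w0C ?starM ?starK//; exact: Fstar.
- have gb : g b = 0 by exact: kill.
  have gsb : g (star b) = 0.
    have [d ->] := ub; rewrite star_sum (tf_sum gl) big1// => k _.
    rewrite starZ (tfZ gl) /u /com starB !starM (tfB gl) gt; try exact: Fstar.
    by rewrite subrr mulr0.
  rewrite /w /w0 (tfZ gl) starB sc (tfD gl) !(tfB gl) gb gsb !subr0.
  exact/esym/half_double.
Qed.

(** Left multiplication by [w - k], written without a unit. *)
Definition wshift (w : A) (k : R[i]) (x : A) := w ** x - k *: x.

(** Cayley-Hamilton for a matrix of left multiplication by [w], whose characteristic polynomial
    splits over [R[i]]. As the generators may be dependent, the matrix is a choice; the map [phi]
    from row vectors onto [F] intertwines it with [w]. *)
Lemma wshift_killed w : F w -> exists l : seq R[i], forall x, F x ->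
  foldl (fun y k => wshift w k y) x l = 0.
Proof.
case: n v Fv => [u Fu|m u Fu] Fw.
  by exists [::] => x /=; rewrite Fu => -[c ->]; rewrite big_ord0.
have Fui i : F (u i) by rewrite Fu; exact: spanned_gen.
have /(_ _)/cid-/all_sig[W WE] i : exists c : 'I_m.+1 -> R[i],
    w ** u i = \sum_j c j *: u j.
  by have := FM Fw (Fui i); rewrite {1}Fu.
pose M : 'M[R[i]]_m.+1 := \matrix_(i, j) W i j.
pose phi (r : 'rV[R[i]]_m.+1) := \sum_i r 0 i *: u i.
have phiM (r : 'rV_m.+1) k : phi (r *m (M - k%:M)) = wshift w k (phi r).
  have -> : phi (r *m (M - k%:M)) = phi (r *m M) - k *: phi r.
    rewrite mulmxBr mul_mx_scalar /phi scaler_sumr -sumrB.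
    by apply: eq_bigr => i _; rewrite !mxE scalerBl scalerA.
  congr (_ - _); rewrite /phi smul_sumr.
  under [RHS]eq_bigr do rewrite smulZr WE scaler_sumr.
  rewrite exchange_big/=; apply: eq_bigr => j _.
  rewrite !mxE scaler_suml; apply: eq_bigr => i _.
  by rewrite !mxE scalerA.
have [l lE] := closed_field_poly_normal (char_poly M).
exists l => x; rewrite Fu => -[c xE].
have -> : x = phi (\row_i c i).
  by rewrite xE; apply: eq_bigr => i _; rewrite !mxE.
suff lP (s : seq R[i]) r : foldl (fun y k => wshift w k y) (phi r) s =
    phi (r *m \prod_(z <- s) (M - z%:M)).
  rewrite lP (_ : \prod_(z <- l) _ = 0).
    by rewrite mulmx0 /phi big1// => i _; rewrite mxE scale0r.
  have := Cayley_Hamilton M; rewrite lE (monicP (char_poly_monic M)) scale1r.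
  rewrite rmorph_prod => <-; apply: eq_bigr => z _.
  by rewrite rmorphB /= horner_mx_X horner_mx_C.
elim: s r => [|z s IH] r /=; first by rewrite big_nil mulmx1.
by rewrite -phiM IH big_cons mulmxA.
Qed.

(** Put [d = (w - k) x] and let [k'] be the conjugate of [k]. Self-adjointness gives
    [star d d = (k - k') (star x d)] and [(k - k') (star d d) = 0], so [d] vanishes whether [k] is
    real or not. *)
Lemma wshift_ker2 w k x : star w = w ->
  wshift w k (wshift w k x) = 0 -> wshift w k x = 0.
Proof.
set d := wshift w k x => sw /eqP; rewrite subr_eq0 => /eqP wd.
have dE : star d ** d = (k - k^* ) *: (star x ** d).
  rewrite {1}/d /wshift starB starM starZ sw smulBl -smulA wd smulZr smulZl.
  by rewrite scalerBl.
have dd : star d ** (w ** d) = k *: (star d ** d) by rewrite wd smulZr.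
have : (k - k^* ) *: (star d ** d) = 0.
  by rewrite scalerBl -dd smulA -{1}sw -starM wd starZ smulZl subrr.
move/eqP; rewrite scaler_eq0 => /orP[/eqP k0|/eqP/cstar_eq0//].
by apply: cstar_eq0; rewrite dE k0 scale0r.
Qed.

(** The eigencomponents of [(w - k) x] at values [m] other than [k] are divided by [m - k]. What
    they leave of [x] is killed by the square of [w - k], hence by [w - k] itself. Roots may repeat
    in [l], whence [undup]. *)
Lemma eigen_decomposition w x (l : seq R[i]) : F w -> star w = w -> F x ->
  foldl (fun y k => wshift w k y) x l = 0 ->
  exists z : R[i] -> A, [/\ forall k, F (z k), forall k, w ** z k = k *: z k
    & x = \sum_(k <- undup l) z k].
Proof.
move=> Fw sw; elim: l x => [|k l IH] x Fx /=.
  move=> ->; exists (fun=> 0); split=> // [k|]; last by rewrite big_nil.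
  by rewrite smul0r scaler0.
move=> /IH[|z [Fz wz yE]]; first by apply: FB; [exact: FM|exact: FZ].
pose r (m : R[i]) := (m - k)^-1 *: z m.
have Fr m : F (r m) by exact: FZ.
pose rest := \sum_(m <- undup l | m != k) r m.
have Frest : F rest by apply: (big_ind F).
pose x0 := x - rest.
have restE : wshift w k rest = \sum_(m <- undup l | m != k) z m.
  rewrite /wshift /rest smul_sumr scaler_sumr -sumrB; apply: eq_bigr => m mk.
  rewrite /r smulZr wz !scalerA -scalerBl (mulrC k) -mulrBr mulVf ?scale1r//.
  by rewrite subr_eq0.
have x0E : wshift w k x0 = \sum_(m <- undup l | m == k) z m.
  have -> : wshift w k x0 = wshift w k x - wshift w k rest.
    by rewrite /wshift /x0 smulBr scalerBr !opprD !opprK addrACA.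
  rewrite restE yE (bigID (fun m => m == k))/= addrK//.
have wx0 : wshift w k x0 = 0.
  apply: wshift_ker2 => //; rewrite x0E /wshift smul_sumr scaler_sumr -sumrB.
  by rewrite big1// => m /eqP ->; rewrite wz subrr.
pose z' m := if m == k then x0 else r m.
exists z'; split=> [m|m|].
- by rewrite /z'; case: ifP => // _; exact: FB.
- rewrite /z'; case: eqP => [->|_].
    by apply/eqP; rewrite -subr_eq0; apply/eqP.
  by rewrite /r smulZr wz !scalerA mulrC.
- have sumE : \sum_(m <- undup l | m != k) z' m = rest.
    by apply: eq_bigr => m /negPf mk; rewrite /z' mk.
  have z'k : z' k = x0 by rewrite /z' eqxx.
  case: ifP => kl.
    rewrite (bigD1_seq k) ?undup_uniq ?mem_undup//= sumE z'k.
    by rewrite subrK.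
  rewrite big_cons z'k (_ : \sum_(j <- undup l) z' j = rest) ?subrK//.
  rewrite -sumE [RHS]big_seq_cond big_seq; apply: eq_bigl => m.
  case: eqP => [->|]; last by rewrite andbT.
  by rewrite mem_undup kl.
Qed.

(** The projections are the eigencomponents of the unit [e]. As [w] is central, [star (z k) y (z m)]
    vanishes for all [y] in [F] unless [m] is the conjugate of [k]. This yields in turn real
    eigenvalues, orthogonality, self-adjointness and centrality. *)
Lemma spectral_projections e w : F e -> (forall x, F x -> e ** x = x /\ x ** e = x) ->
  F w -> star w = w -> central_in F w ->
  exists (s : seq R[i]) (z : R[i] -> A),
  [/\ [/\ uniq s, forall k, F (z k) & e = \sum_(k <- s) z k],
      forall k, k \in s -> projection (z k),
      forall k m, k \in s -> m \in s -> k != m -> z k ** z m = 0,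
      forall k, k \in s -> w ** z k = ((complex.Re k)%:C)%C *: z k
    & forall k, k \in s -> central_in F (z k)].
Proof.
move=> Fe eE Fw sw cw.
have [l lP] := wshift_killed Fw.
have [z [Fz wz ez]] := eigen_decomposition Fw sw Fe (lP e Fe).
have zw k : star (z k) ** w = k^* *: star (z k) by rewrite -{1}sw -starM wz starZ.
have cross y k m : F y -> star (z k) ** (y ** z m) != 0 -> k^* = m.
  move=> Fy; apply: contraNeq => km.
  have : (k^* - m) *: (star (z k) ** (y ** z m)) = 0.
    rewrite scalerBl -smulZl -zw -smulA (smulA w) cw// -smulA wz.
    by rewrite !smulZr subrr.
  by move/eqP; rewrite scaler_eq0 subr_eq0 (negPf km).
have real k : z k != 0 -> k^* = k.
  move=> zk; apply: (cross e) => //; rewrite (eE _ (Fz k)).1.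
  by apply: contraNneq zk => /cstar_eq0 ->.
(* Components at non-real [k] are 0, so every eigenvalue may be replaced by its real part. *)
have zReal k : k *: z k = ((complex.Re k)%:C)%C *: z k.
  have [->|/real] := eqVneq (z k) 0; first by rewrite !scaler0.
  case: k => a b [] bb; congr (_ *: _); apply/eqP; rewrite eq_complex /= eqxx/=.
  by apply/eqP; lra.
have orth y k m : F y -> k != m -> star (z k) ** (y ** z m) = 0.
  move=> Fy km; have [->|/real rk] := eqVneq (z k) 0; first by rewrite star0 smul0l.
  by apply: contraNeq km => /(cross _ _ _ Fy); rewrite rk => ->.
have zz k : k \in undup l -> star (z k) = star (z k) ** z k.
  move=> kl; rewrite -[LHS](eE _ (Fstar (Fz k))).2 ez smul_sumr.
  rewrite (bigD1_seq k) ?undup_uniq//= big1 ?addr0// => m mk.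
  by rewrite -(eE _ (Fz m)).1 orth// eq_sym.
have sz k : k \in undup l -> star (z k) = z k.
  by move=> kl; rewrite -[RHS]starK zz// starM starK -zz.
exists (undup l), z; split=> //; first by rewrite undup_uniq.
- by move=> k kl; split; rewrite ?sz//; rewrite -{1}(sz k)// -zz// sz.
- by move=> k m kl ml km; rewrite -(eE _ (Fz m)).1 -{1}(sz k)// orth.
- by move=> k _; rewrite wz zReal.
(* Expanding [e] on the left of [y z k] leaves the single term [z k y z k]; the adjoint statement
   gives the same value for [z k y]. *)
- have comp k y : k \in undup l -> F y -> y ** z k = z k ** (y ** z k).
    move=> kl Fy; rewrite -[LHS](eE _ (FM Fy (Fz k))).1 {1}ez smul_suml.
    rewrite (bigD1_seq k) ?undup_uniq//= [X in _ + X]big_seq_cond.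
    rewrite big1 ?addr0// => m /andP[ml mk].
    by rewrite -(sz m)// orth.
  move=> k kl y Fy; rewrite comp//.
  have := comp k _ kl (Fstar Fy) => /(congr1 star).
  by rewrite !starM starK sz// smulA.
Qed.

Definition central_projection (V : set A) (p : A) :=
  [/\ V p, projection p & central_in V p].

Lemma central_projectionM p q : central_projection F p -> central_projection F q ->
  central_projection F (p ** q).
Proof.
move=> [Fp [sp pp] cp] [Fq [sq qq] cq]; split; first exact: FM.
- by split; [rewrite starM sp sq cp|rewrite smulA -(smulA p) -(cp q)// smulA pp -smulA qq].
- by move=> y Fy; rewrite -smulA cq// smulA cp// smulA.
Qed.

(** [p] collects the spectral projections of the central representative [w] of [c] at eigenvalues
    [<= 0]. As [p u] is central, [g (x p u)] is tracial in [x] on [F], so [c] may be replaced by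
    [w], and the values become sums of eigenvalues with nonnegative weights. The factor [u]
    preserves the signs under further cutting by central projections. *)
Lemma sign_projection e c : F e -> (forall x, F x -> e ** x = x /\ x ** e = x) ->
  F c -> star c = c ->
  exists p, [/\ central_projection F p, central_projection F (e - p) &
    forall g u, tracial_functional g -> central_projection F u ->
    rf g (c ** (p ** u)) <= 0 <= rf g (c ** ((e - p) ** u))].
Proof.
move=> Fe eE Fc sc; have [w [Fw sw cw cwE]] := central_representative Fc sc.
have [s [z [[us Fz ez] zproj zorth wz cz]]] := spectral_projections Fe eE Fw sw cw.
pose P (Q : pred R[i]) := \sum_(k <- s | Q k) z k.
have PE Q x : (P Q) ** x = \sum_(k <- s | Q k) z k ** x by exact: smul_suml.
have zP Q k : k \in s -> z k ** P Q = if Q k then z k else 0.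
  move=> ks; rewrite /P smul_sumr; case: ifP => Qk.
    rewrite big_mkcond/= (bigD1_seq k)//= Qk (zproj k ks).2 big_seq_cond.
    rewrite big1 ?addr0// => m /andP[ms mk].
    by case: ifP => // _; rewrite zorth// eq_sym.
  rewrite big_seq_cond big1// => m /andP[ms Qm]; rewrite zorth//.
  by apply: contraTneq Qm => <-; rewrite Qk.
have FP Q : F (P Q) by apply: (big_ind F).
have cP Q : central_in F (P Q).
  move=> y Fy; rewrite PE smul_sumr big_seq_cond [RHS]big_seq_cond.
  by apply: eq_bigr => k /andP[ks _]; exact: cz.
have projP Q : central_projection F (P Q).
  split=> //; split.
    rewrite star_sum big_seq_cond [RHS]big_seq_cond; apply: eq_bigr => k /andP[ks _].
    by case: (zproj k ks).
  rewrite PE big_seq_cond [RHS]big_seq_cond; apply: eq_bigr => k /andP[ks Qk].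
  by rewrite zP// Qk.
pose N k := complex.Re k <= 0 :> R.
have eP : e - P N = P (predC N).
  by rewrite ez (bigID N)/= addrAC subrr add0r.
exists (P N); rewrite eP; split=> // g u G [Fu [su uu] cu].
have Q Q : rf g (c ** (P Q ** u)) = \sum_(k <- s | Q k) complex.Re k * rf g (z k ** u).
  have -> : rf g (c ** (P Q ** u)) = rf g (w ** (P Q ** u)).
    congr (complex.Re _); apply: (cwE (fun x => g (x ** (P Q ** u)))).
      by move=> k x y; rewrite smulDl smulZl (tf_linear G).
    move=> x y Fx Fy.
    have [_ _ cPu] : central_projection F (P Q ** u) by apply: central_projectionM.
    by rewrite -smulA -cPu// smulA (tf_comm G) smulA.
  rewrite PE smul_sumr (rf_sum G) big_seq_cond [RHS]big_seq_cond.
  by apply: eq_bigr => k /andP[ks _]; rewrite smulA wz// smulZl (rfZ G).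
have pos k : k \in s -> 0 <= rf g (z k ** u).
  move=> ks; have [Fzk [s1 p1] c1] : central_projection F (z k ** u).
    by apply: central_projectionM => //; split=> //; [exact: zproj|exact: cz].
  by rewrite -p1 -{1}s1; exact: rf_pos.
rewrite !Q big_seq_cond [X in 0 <= X]big_seq_cond; apply/andP; split.
- apply: sumr_le0 => k /andP[ks]; rewrite /N => k0.
  by apply: mulr_le0_ge0 => //; exact: pos.
- apply: sumr_ge0 => k /andP[ks /=]; rewrite /N -ltNge => k0.
  by apply: mulr_ge0; [exact: ltW|exact: pos].
Qed.

(** Every step splits what the earlier ones left: [r i] is the product of the complements [e - P j]
    for [j < i], [p i] is [P i r i], and the remainder [q] is [r m]. The sum telescopes. *)
Lemma sign_partition e (c : nat -> A) (m : nat) :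
  F e -> projection e -> (forall x, F x -> e ** x = x /\ x ** e = x) ->
  (forall i, F (c i)) -> (forall i, star (c i) = c i) ->
  exists (p : nat -> A) (q : A),
  [/\ forall i, central_projection F (p i), central_projection F q,
      forall i j, (i < j < m)%N -> p i ** p j = 0 /\ p j ** p i = 0,
      (forall i, (i < m)%N -> p i ** q = 0 /\ q ** p i = 0) /\
        \sum_(i < m) p i + q = e
    & forall g i, tracial_functional g -> (i < m)%N ->
       rf g (c i ** p i) <= 0 <= rf g (c i ** q)].
Proof.
move=> Fe pe eE Fc sc.
have /(_ _)/cid-/all_sig[P PP] i := sign_projection Fe eE (Fc i) (sc i).
have cpP i : central_projection F (P i) by case: (PP i).
have cpeP i : central_projection F (e - P i) by case: (PP i).
pose r := fix r i := if i is j.+1 then (e - P j) ** r j else e.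
have cpe : central_projection F e by split=> // y Fy; rewrite !(eE _ Fy).1 (eE _ Fy).2.
have cpr i : central_projection F (r i).
  by elim: i => [|i IH] //=; exact: central_projectionM.
have Fr i : F (r i) by case: (cpr i).
have FP i : F (P i) by case: (cpP i).
have rC i y : F y -> r i ** y = y ** r i by case: (cpr i) => _ _; apply.
have PC i y : F y -> P i ** y = y ** P i by case: (cpP i) => _ _; apply.
have eP i : (e - P i) ** (e - P i) = e - P i by case: (cpeP i) => _ [].
have rr i j : (i < j)%N -> r j = (e - P i) ** r j.
  elim: j => // j IH; rewrite ltnS leq_eqVlt => /predU1P[->|/IH rj] /=.
    by rewrite smulA eP.
  have [_ _ cj] := cpeP j.
  by rewrite smulA -cj -?smulA -?rj//; case: (cpeP i).
have Pr i j : (i < j)%N -> P i ** r j = 0.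
  move=> /rr ->; rewrite smulA smulBr (eE _ (FP i)).2.
  by have [_ [_ ->] _] := cpP i; rewrite subrr smul0l.
pose p i := P i ** r i.
have cpp i : central_projection F (p i) by exact: central_projectionM.
have Fp i : F (p i) by case: (cpp i).
have pC i y : F y -> p i ** y = y ** p i by case: (cpp i) => _ _; apply.
have pr i j : (i < j)%N -> p i ** r j = 0.
  by move=> /Pr ij; rewrite /p -smulA rC// smulA ij smul0l.
exists p, (r m); split=> //.
- move=> i j /andP[ij _]; have h : p i ** p j = 0.
    by rewrite {2}/p PC// smulA pr// smul0l.
  by split=> //; rewrite pC.
- split; first by move=> i im; split; [exact: pr|rewrite rC// pr].
  elim: m => [|k IH]; first by rewrite big_ord0 add0r.
  rewrite big_ord_recr/= -[RHS]IH -addrA; congr (_ + _).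
  by rewrite smulBl (eE _ (Fr k)).1 /p addrC subrK.
- move=> g i G im; have [_ _ h] := PP i.
  have /andP[-> _] := h g (r i) G (cpr i).
  by rewrite (rr i m im); have /andP[] := h g (r m) G (cpr m).
Qed.

End finite_dimensional_algebra.

(** * The uniform trace norm *)

Lemma ultra_fmap (T V : Type) (f : T -> V) (U : set_system T) :
  UltraFilter U -> UltraFilter (f @ U).
Proof.
move=> UU; split=> [|G GG UG]; first exact: fmap_proper_filter.
apply/predeqP => B; split; last exact: UG.
move=> GB; have [//|nB] := in_ultra_setVsetC (f @^-1` B) UU.
have /filter_ex[t []//] : G (B `&` ~` B) by apply: filterI => //; exact: UG.
Qed.

Section norm2_facts.
Context {R : realType} (M : tcAlgType R).
Local Notation C := (R[i]^o).
Local Notation X := (@tc_traces R M).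
Local Notation N := (norm2 X).
Implicit Types a b x y p : M.

Let Xtrace : X `<=` trace := tc_trace (tc_ax M).

Lemma tc_tracial tau : X tau -> tracial_functional tau.
Proof. by move=> /Xtrace/trace_tracial. Qed.

Lemma norm2_ge0 a : 0 <= N a.
Proof. by case: (tc_norm (tc_ax M)). Qed.

Lemma ler_norm2D a b : N (a + b) <= N a + N b.
Proof. by case: (tc_norm (tc_ax M)). Qed.

Lemma norm2N a : N (- a) = N a.
Proof.
case: (tc_norm (tc_ax M)) => _ _ NZ _.
by rewrite -scaleN1r NZ normrN normr1 mul1r.
Qed.

Lemma norm2Zr (r : R) a : N ((r%:C)%C *: a) = `|r| * N a.
Proof.
case: (tc_norm (tc_ax M)) => _ _ NZ _.
by rewrite NZ normc_def /= expr0n addr0 sqrtr_sqr.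
Qed.

Lemma ler_norm2B a b : N (a - b) <= N a + N b.
Proof. by rewrite (le_trans (ler_norm2D _ _))// norm2N. Qed.

Lemma norm2_distC a b : N (a - b) = N (b - a).
Proof. by rewrite -norm2N opprB. Qed.

Lemma ler_norm2_dist a b c : N (a - c) <= N (a - b) + N (b - c).
Proof. by rewrite -(subrKA b) ler_norm2D. Qed.

Lemma ler_gt0_eq0 (r : R) : 0 <= r -> (forall e : R, 0 < e -> r <= e) -> r = 0.
Proof.
move=> r0 re; apply/eqP; rewrite eq_le r0 andbT leNgt; apply/negP => r1.
have := re (r / 2); rewrite divr_gt0//; lra.
Qed.

Lemma norm2_eq0 a : (forall e : R, 0 < e -> N a <= e) -> a = 0.
Proof.
case: (tc_norm (tc_ax M)) => _ _ _ N0 ae; apply: N0.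
exact: (ler_gt0_eq0 (norm2_ge0 a)).
Qed.

Lemma rf_le_norm2 tau a : X tau -> rf tau (star a ** a) <= N a ^+ 2.
Proof.
move=> Xt; have := norm2_ub Xtrace a Xt.
rewrite -(ler_pXn2r (n := 2))// ?nnegrE ?sqrtr_ge0 ?norm2_ge0//.
by rewrite sqr_sqrtr// (rf_pos (tc_tracial Xt)).
Qed.

Lemma norm2_le_rf a (B : R) : 0 <= B ->
  (forall tau, X tau -> rf tau (star a ** a) <= B ^+ 2) -> N a <= B.
Proof.
move=> B0 aB; apply: norm2_le => // tau Xt.
by rewrite -(ger0_norm B0) -sqrtr_sqr ler_wsqrtr// aB.
Qed.

Lemma norm2_rnorm a : N a <= rnorm a.
Proof.
apply: norm2_le_rf; first exact: rnorm_ge0.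
by move=> tau Xt; apply: trace_Re_le; [exact: Xtrace|rewrite normE].
Qed.

Lemma rf_le_rnorm tau a : X tau -> rf tau a <= rnorm a.
Proof.
by move=> /Xtrace T; rewrite (le_trans (Re_le_norm _))// ler_Re// trace_norm.
Qed.

Lemma rf_norm_le_rnorm tau a : X tau -> `|rf tau a| <= rnorm a.
Proof.
move=> Xt; rewrite ler_norml rf_le_rnorm// andbT lerNl.
by rewrite -(rfN (tc_tracial Xt)) -rnormN rf_le_rnorm.
Qed.

Lemma rf_norm2_inner tau a b : X tau -> `|rf tau (a ** b)| <= N a * N b.
Proof.
move=> Xt; have T := tc_tracial Xt.
rewrite -(ler_pXn2r (n := 2))// ?nnegrE ?mulr_ge0 ?norm2_ge0//.
rewrite real_normK ?num_real// -(starK a) exprMn.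
rewrite (le_trans (rf_cauchy_schwarz T _ _))// norm2_star//.
by apply: ler_pM; rewrite ?(rf_pos T) ?rf_le_norm2// -norm2_star ?rf_le_norm2.
Qed.

Lemma norm2_starE a : N (star a) = N a.
Proof. exact: norm2_star. Qed.

Lemma norm2_projl p x : projection p -> N (p ** x) <= N x.
Proof.
move=> pp; apply: norm2_le_rf; first exact: norm2_ge0.
move=> tau Xt; rewrite (le_trans (rf_projection_le (tc_tracial Xt) _ pp))//.
exact: rf_le_norm2.
Qed.

Lemma norm2_projr p x : projection p -> N (x ** p) <= N x.
Proof.
move=> pp; rewrite -norm2_starE starM (_ : star p = p); last by case: pp.
by rewrite (le_trans (norm2_projl _ pp))// norm2_starE.
Qed.

Lemma norm2_proj p : projection p -> N p <= 1.
Proof. by move=> /rnorm_projection; exact/le_trans/norm2_rnorm. Qed.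

(** Continuity of multiplication for [N] on operator-norm balls: [d] inverts the bound of
    [norm2_smul]. For [L < 0] no [b] qualifies. *)
Lemma norm2_small_mull (K L e : R) : 0 < e -> exists2 d : R, 0 < d &
  forall a b, rnorm a <= K -> rnorm b <= L -> N b <= d -> N (a ** b) <= e.
Proof.
move=> e0; have [L0|L0] := leP 0 L; last first.
  by exists 1 => // a b _ bL; have := rnorm_ge0 b; lra.
have T0 : 0 < K ^+ 2 * L + 1 by rewrite ltr_wpDl// mulr_ge0// sqr_ge0.
exists (e ^+ 2 / (K ^+ 2 * L + 1)); first by rewrite divr_gt0// exprn_gt0.
move=> a b aK bL bd.
have h : N (a ** b) <= Num.sqrt (N b * (K ^+ 2 * L + 1)).
  by apply: norm2_smul; rewrite // normE lecR.
rewrite (le_trans h)// -(ger0_norm (ltW e0)) -sqrtr_sqr ler_wsqrtr//.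
by rewrite -ler_pdivlMr.
Qed.

Lemma norm2_small_mulr (K L e : R) : 0 < e -> exists2 d : R, 0 < d &
  forall a b, rnorm a <= K -> rnorm b <= L -> N b <= d -> N (b ** a) <= e.
Proof.
move=> /(norm2_small_mull K L)[d d0 dP]; exists d => // a b aK bL bd.
by rewrite -norm2_starE starM dP ?rnorm_star ?norm2_starE.
Qed.

Lemma tc_separated : separated_by_traces (A := M).
Proof.
move=> x x0; apply: norm2_eq0 => e e0; rewrite (le_trans _ (ltW e0))//.
apply: norm2_le_rf => // tau Xt.
by rewrite x0 ?expr0n//; exact: tc_tracial.
Qed.

Definition norm2_cvg (u : nat -> M) (a : M) := forall e : R, 0 < e ->
  exists n0 : nat, forall n, (n0 <= n)%N -> N (u n - a) <= e.

Lemma norm2_cvg_unique u a b : norm2_cvg u a -> norm2_cvg u b -> a = b.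
Proof.
move=> ua ub; apply/eqP; rewrite -subr_eq0; apply/eqP/norm2_eq0 => e e0.
have e2 : 0 < e / 2 by rewrite divr_gt0.
have [n0 n0P] := ua _ e2; have [n1 n1P] := ub _ e2.
rewrite (le_trans (ler_norm2_dist a (u (n0 + n1)%N) b))// norm2_distC.
have := n0P _ (leq_addr n1 n0); have := n1P _ (leq_addl n0 n1); lra.
Qed.

Lemma norm2_cvg_cst a : norm2_cvg (fun=> a) a.
Proof.
move=> e e0; exists 0 => n _; rewrite subrr (le_trans (norm2_rnorm _))//.
by rewrite rnorm0 ltW.
Qed.

Lemma norm2_cvgB u v a b : norm2_cvg u a -> norm2_cvg v b ->
  norm2_cvg (fun n => u n - v n) (a - b).
Proof.
move=> ua vb e e0; have e2 : 0 < e / 2 by rewrite divr_gt0.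
have [n0 n0P] := ua _ e2; have [n1 n1P] := vb _ e2.
exists (n0 + n1)%N => n nn.
rewrite (_ : _ - (a - b) = (u n - a) - (v n - b)); last first.
  by rewrite !opprD !opprK addrACA.
rewrite (le_trans (ler_norm2B _ _))//.
have := n0P _ (leq_trans (leq_addr n1 n0) nn).
have := n1P _ (leq_trans (leq_addl n0 n1) nn); lra.
Qed.

Lemma norm2_cvg_star u a : norm2_cvg u a -> norm2_cvg (fun n => star (u n)) (star a).
Proof.
move=> ua e /ua[n0 n0P]; exists n0 => n /n0P.
by rewrite -starB norm2_starE.
Qed.

Lemma norm2_cvg_mull u a x : (forall n, rnorm (u n) <= 1) -> norm2_cvg u a ->
  norm2_cvg (fun n => x ** u n) (x ** a).
Proof.
move=> u1 ua e /(norm2_small_mull (rnorm x) (1 + rnorm a))[d d0 dP].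
have [n0 n0P] := ua _ d0; exists n0 => n nn; rewrite -smulBr dP ?n0P//.
by rewrite (le_trans (ler_rnormB _ _))// lerD2r.
Qed.

Lemma norm2_cvg_mulr u a x : (forall n, rnorm (u n) <= 1) -> norm2_cvg u a ->
  norm2_cvg (fun n => u n ** x) (a ** x).
Proof.
move=> u1 ua e /(norm2_small_mulr (rnorm x) (1 + rnorm a))[d d0 dP].
have [n0 n0P] := ua _ d0; exists n0 => n nn; rewrite -smulBl dP ?n0P//.
by rewrite (le_trans (ler_rnormB _ _))// lerD2r.
Qed.

Lemma norm2_ball_complete u : (forall n, rnorm (u n) <= 1) ->
  (forall e : R, 0 < e -> exists n0 : nat, forall m n,
     (n0 <= m)%N -> (n0 <= n)%N -> N (u m - u n) < e) ->
  exists2 a, rnorm a <= 1 & norm2_cvg u a.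
Proof.
move=> u1 /(tc_complete (tc_ax M))[n|a a1 ua].
  by rewrite normE lecR.
exists a; first by rewrite -lecR -normE.
move=> e e0; have /cvgrPdist_le/(_ _ e0)[n0 _ n0P] := ua.
exists n0 => n /n0P; rewrite /= sub0r normrN.
exact/le_trans/ler_norm.
Qed.

(** * Limits along ultrafilters *)

Section ultralimits.
Variables (T : Type) (U : set_system T).
Context {UU : UltraFilter U}.

Lemma ultra_bounded_limit (g : T -> R) (K : R) : U [set t | `|g t| <= K] ->
  exists l : R, forall e : R, 0 < e -> U [set t | `|g t - l| < e].
Proof.
move=> gK; have gI : U (g @^-1` `[- K, K]).
  by apply: filterS gK => t /=; rewrite in_itv /= -ler_norml.
have := @segment_compact R (- K) K; rewrite compact_ultra.
move=> /(_ (g @ U) (ultra_fmap g UU) gI)[].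
move=> l [_ gl]; exists l => e e0.
have /cvgrPdist_lt/(_ _ e0) : g @ U --> l by [].
by apply: filterS => t; rewrite distrC.
Qed.

(** Compactness of [X], applied to the image of the ultrafilter under [h]. *)
Lemma ultra_trace_limit (h : T -> M -> C) : U [set t | X (h t)] ->
  exists2 tau, X tau &
    forall a (e : R), 0 < e -> U [set t | `|rf (h t) a - rf tau a| < e].
Proof.
move=> Xh; have := tc_compact (tc_ax M); rewrite compact_ultra.
move=> /(_ (h @ U) (ultra_fmap h UU) Xh)[tau [Xt htau]]; exists tau => // a e e0.
have ec : 0 < ((e%:C)%C : R[i]) by rewrite ltcR.
have Ut : U [set t | `|tau a - h t a| < ((e%:C)%C : R[i])].
  by have /pointwise_cvgP/(_ a)/cvgrPdist_lt/(_ _ ec) : {ptws, h @ U --> tau} by [].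
apply: filterS Ut => t /= ht.
rewrite /rf distrC -ReB -ltcR (le_lt_trans _ ht)//.
exact: normc_ge_Re.
Qed.

End ultralimits.
End norm2_facts.

(** * Products are norm dense *)

Section products.
Context {R : realType} (M : tcAlgType R).
Local Notation C := (R[i]^o).
Local Notation X := (@tc_traces R M).
Local Notation N := (norm2 X).
Implicit Types a b x y z g p : M.

Lemma iR_sqr : ('i)%C * ('i)%C = -1 :> R[i].
Proof. by rewrite -expr2 sqr_i. Qed.

(** In the square of [x + i y] the mixed terms cancel by the first hypothesis; the rest is the norm
    identity for squares. *)
Lemma rnorm_unitary_parts x y z : star x ** y = star y ** x ->
  star x ** x + star y ** y = star z ** z ->
  rnorm (x + ('i)%C *: y) = rnorm z.
Proof.
move=> xy xyz; apply/eqP.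
rewrite -(eqrXn2 (n := 2))// ?rnorm_ge0// -!rnorm_starM -xyz; apply/eqP.
congr rnorm; rewrite starD starZ conjci smulDl !smulDr !smulZl !smulZr xy.
rewrite !scaleNr !scalerA iR_sqr scaleN1r opprK.
by rewrite addrA addrK.
Qed.

(** [g] stands for [x / (1 + x^2)], obtained without a unit as the fixed point of [T]. For
    [rnorm x <= 3/5] the map [T] contracts by [9/25], and [3/5 + 9/25 <= 1] keeps the iterates in
    the unit ball, which is complete for [N]. *)
Lemma fixpoint_solution x : star x = x -> rnorm x <= 3/5 ->
  exists g, [/\ star g = g, x ** g = g ** x & g = x - x ** (x ** g)].
Proof.
move=> sx x1; pose T y := x - x ** (x ** y).
pose u n := iter n T 0.
have xx y : rnorm (x ** (x ** y)) <= 9/25 * rnorm y.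
  have h := rnormM x (x ** y); have h' := rnormM x y.
  have := rnorm_ge0 x; have := rnorm_ge0 y; have := rnorm_ge0 (x ** y); nra.
have u1 n : rnorm (u n) <= 1.
  elim: n => [|n IH]; first by rewrite rnorm0.
  rewrite /u iterS -/(u n) (le_trans (ler_rnormB _ _))//.
  by have := xx (u n); lra.
have dist n k : rnorm (u (n + k)%N - u n) <= (9/25) ^+ n.
  elim: n => [|n IH]; first by rewrite subr0 expr0.
  rewrite addSn /u !iterS -/(u _) -/(u n) /T opprB addrC addrA subrK.
  rewrite -!smulBr (le_trans (xx _))// exprS.
  by move: IH; rewrite -rnormN opprB => IH; lra.
have [e e0|g g1 ug] := norm2_ball_complete u1.
  have q1 : `|9/25 : R| < 1 by rewrite ger0_norm; lra.
  have e2 : 0 < e / 3 by rewrite divr_gt0.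
  have /cvgrPdist_lt/(_ _ e2)[n0 _ n0P] := cvg_expr q1.
  have qn : (9/25) ^+ n0 < e / 3.
    by have := n0P n0 (leqnn _); rewrite /= sub0r normrN ger0_norm// exprn_ge0.
  exists n0 => m n nm nn.
  rewrite (le_lt_trans (ler_norm2_dist _ (u n0) _))// (norm2_distC (u n0)).
  have := le_trans (norm2_rnorm _) (dist n0 (m - n0)%N).
  have := le_trans (norm2_rnorm _) (dist n0 (n - n0)%N).
  rewrite !subnKC//; lra.
have gE : g = x - x ** (x ** g).
  apply: (@norm2_cvg_unique _ _ (fun n => u n.+1)).
    by move=> e /ug[n0 n0P]; exists n0 => n nn; apply/n0P/leqW.
  apply: norm2_cvgB; first exact: norm2_cvg_cst.
  have := norm2_cvg_mull (x ** x) u1 ug.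
  by rewrite -smulA; under eq_fun do rewrite -smulA.
have xu n : x ** u n = u n ** x.
  elim: n => [|n IH]; first by rewrite smul0l smul0r.
  by rewrite /u iterS -/(u n) /T smulBr smulBl -!smulA IH.
have su n : star (u n) = u n.
  elim: n => [|n IH]; first by rewrite star0.
  by rewrite /u iterS -/(u n) /T starB !starM IH sx -xu -smulA -xu.
exists g; split=> //.
- have sug := norm2_cvg_star ug; apply: (norm2_cvg_unique sug).
  by under eq_fun do rewrite su.
- apply: (norm2_cvg_unique (norm2_cvg_mull x u1 ug)).
  by under eq_fun do rewrite xu; exact: norm2_cvg_mulr.
Qed.

(* With [g = x / (1 + x^2)], the element [2 g + i (1 - x^2) / (1 + x^2)] is
   unitary, whence [2 |g| <= 1]; this bounds [g] without spectral theory. *)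
Lemma rnorm_fixpoint_le x g : star x = x -> star g = g -> x ** g = g ** x ->
  g = x - x ** (x ** g) -> rnorm g <= 1 / 2.
Proof.
move=> sx sg xg gE.
(* The unitary is present only through its action on [z]: [P] is [2 g z] and [Q] is [(1 - 2 x g) z],
   where [1 - 2 x g] stands for [(1 - x^2) / (1 + x^2)]. Both [P + i Q] and [P - i Q] have the norm
   of [z] and their sum is [4 g z]. The case [z = g] bounds [g]. *)
have gz z : 2 * rnorm (g ** z) <= rnorm z.
  pose G := g ** z; pose t := x ** G.
  pose P := G + G; pose Q := z - (t + t).
  have sG : star G = star z ** g by rewrite starM sg.
  have st : star t = star z ** (x ** g) by rewrite starM sG sx xg -smulA.
  pose D := star z ** t; pose E := star t ** t.
  have stz : star t ** z = D by rewrite st /D /t /G !smulA.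
  have Gz : star G ** z = star z ** G by rewrite sG -smulA.
  have Gt : star G ** t = star t ** G.
    by rewrite sG st /t !smulA -(smulA _ g x) -xg smulA.
  have GG : star G ** G = D - E.
    have xxg : x ** (x ** g) = (x ** g) ** x by rewrite -smulA -xg.
    rewrite /D /E sG st /t /G -!(smulA (star z)) -smulBr; congr (_ ** _).
    by rewrite {1}gE smulBl xxg !smulA.
  have PQ : star P ** Q = star Q ** P.
    by rewrite /P /Q starD starB starD smulBr smulBl !smulDl !smulDr Gz Gt.
  have PPQQ : star P ** P + star Q ** Q = star z ** z.
    rewrite /P /Q starD starB starD smulBr !smulBl !smulDl !smulDr.
    rewrite GG stz -/D -/E.
    rewrite (addrACA D) -opprD.
    move: (D + D) (E + E) (star z ** z) => d e' Z.
    rewrite (addrACA d) -opprD (_ : Z - d - _ = Z - (d + d - (e' + e'))).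
      by rewrite addrCA subrr addr0.
    by rewrite -addrA -opprD addrA.
  have UV : rnorm (P + ('i)%C *: Q) = rnorm z by exact: rnorm_unitary_parts.
  have VU : rnorm (P - ('i)%C *: Q) = rnorm z.
    rewrite -scalerN; apply: rnorm_unitary_parts; rewrite starN.
      by rewrite smulNr smulNl PQ.
    by rewrite smulNl smulNr opprK.
  have GE : G + G + (G + G) = (P + ('i)%C *: Q) + (P - ('i)%C *: Q).
    by rewrite [RHS]addrACA subrr addr0.
  have nG : rnorm (G + G + (G + G)) = 4 * rnorm G.
    have -> : G + G + (G + G) = ((4%:R)%:C)%C *: G.
      by rewrite rmorph_nat scaler_nat !mulrS mulr0n addr0 !addrA.
    by rewrite rnormZr ger0_norm.
  have := ler_rnormD (P + ('i)%C *: Q) (P - ('i)%C *: Q).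
  rewrite -GE nG UV VU -/G; lra.
have := gz g; rewrite -{1}sg rnorm_starM; have := rnorm_ge0 g; nra.
Qed.

(** Rescale [x] to [y] of norm [3/5]. By [g = y - y (y g)], removing a product from [x] leaves a
    multiple of [g], and [rnorm g <= 1/2] gives the factor [5/3 * 1/2 = 5/6]. The difference is
    again self-adjoint, so the step can be iterated. *)
Lemma product_approximation1 x : star x = x -> exists a b,
  star (x - a ** b) = x - a ** b /\ rnorm (x - a ** b) <= 5/6 * rnorm x.
Proof.
move=> sx; have [x0|x0] := eqVneq (rnorm x) 0.
  by exists 0, 0; rewrite smul0l subr0 x0 mulr0.
have xp : 0 < rnorm x by rewrite lt_def x0 rnorm_ge0.
pose k := (3/5) / rnorm x; have k0 : 0 < k by rewrite divr_gt0//; lra.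
pose y := (k%:C)%C *: x.
have sy : star y = y by rewrite starZ conjcR sx.
have y1 : rnorm y <= 3/5.
  by rewrite rnormZr ger0_norm ?(ltW k0)// /k divfK.
have [g [sg xg gE]] := fixpoint_solution sy y1.
have g1 := rnorm_fixpoint_le sy sg xg gE.
pose r : R := k^-1.
exists ((r%:C)%C *: y), (y ** g).
have -> : x - ((r%:C)%C *: y) ** (y ** g) = (r%:C)%C *: g.
  rewrite [in RHS]gE scalerBr smulZl; congr (_ - _).
  by rewrite /y scalerA -rmorphM mulVf ?scale1r// gt_eqF.
split; first by rewrite starZ conjcR sg.
rewrite rnormZr ger0_norm ?invr_ge0 ?(ltW k0)//.
have -> : r = rnorm x * (5/3) by rewrite /r /k; field.
nra.
Qed.

Definition sum_products (s : seq (M * M)) := \sum_(ab <- s) ab.1 ** ab.2.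

Lemma product_approximation_sa x n : star x = x ->
  exists s, rnorm (x - sum_products s) <= (5/6) ^+ n * rnorm x.
Proof.
elim: n x => [|n IH] x sx.
  by exists [::]; rewrite /sum_products big_nil subr0 mul1r.
have [a [b [sab ab]]] := product_approximation1 sx.
have [s sP] := IH _ sab; exists ((a, b) :: s).
rewrite /sum_products big_cons opprD addrA (le_trans sP)// exprSr -mulrA.
by rewrite ler_wpM2l// exprn_ge0; lra.
Qed.

(** As long as there is no unit, Cauchy-Schwarz bounds a trace in terms of [N] on products; norm
    density of sums of products extends such estimates to all elements. *)
Lemma product_approximation x (e : R) : 0 < e ->
  exists s, rnorm (x - sum_products s) <= e.
Proof.
move=> e0.
have sa y : star y = y -> exists s, rnorm (y - sum_products s) <= e / 2.
  move=> sy; have e2 : 0 < e / 2 / (rnorm y + 1).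
    by rewrite !divr_gt0// ltr_wpDl// rnorm_ge0.
  have q1 : `|5/6 : R| < 1 by rewrite ger0_norm; lra.
  have /cvgrPdist_lt/(_ _ e2)[n0 _ /(_ n0 (leqnn _))] := cvg_expr q1.
  rewrite /= sub0r normrN ger0_norm ?exprn_ge0// => qn.
  have [s sP] := product_approximation_sa n0 sy; exists s.
  have y1 : 0 < rnorm y + 1 by rewrite ltr_wpDl// rnorm_ge0.
  rewrite (le_trans sP)//; move: qn; rewrite ltr_pdivlMr// => qn.
  have q0 : 0 <= (5/6 : R) ^+ n0 by rewrite exprn_ge0.
  nra.
pose h := ((2^-1)%:C)%C *: (x + star x).
pose k := ((2^-1)%:C)%C *: (('i)%C *: (star x - x)).
have sh : star h = h by rewrite starZ conjcR starD starK addrC.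
have sk : star k = k.
  rewrite starZ conjcR starZ conjci starB starK scaleNr -scalerN opprB.
  by [].
have xE : x = h + ('i)%C *: k.
  rewrite /h /k scalerA mulrC -scalerA -scalerDr scalerA iR_sqr scaleN1r opprB.
  rewrite addrACA subrr addr0 scalerDr -scalerDl.
  have -> : ((2^-1)%:C)%C + ((2^-1)%:C)%C = 1 :> R[i].
    by rewrite -[RHS]half_double mulrDr !mulr1.
  by rewrite scale1r.
have [s sP] := sa h sh; have [t tP] := sa k sk.
exists (s ++ [seq (('i)%C *: ab.1, ab.2) | ab <- t]).
rewrite /sum_products big_cat big_map/=.
have -> : \sum_(ab <- t) (('i)%C *: ab.1) ** ab.2 = ('i)%C *: sum_products t.
  by rewrite scaler_sumr; apply: eq_bigr => ab _; rewrite smulZl.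
rewrite {1}xE opprD addrACA -scalerBr (le_trans (ler_rnormD _ _))//.
rewrite rnormZ normc_def/= expr0n expr1n add0r sqrtr1 mul1r.
rewrite -/(sum_products s); lra.
Qed.

End products.

(** * The unit *)

Section unit.
Context {R : realType} (M : tcAlgType R).
Local Notation C := (R[i]^o).
Local Notation X := (@tc_traces R M).
Local Notation N := (norm2 X).
Implicit Types a b x y z p : M.
Hypothesis Mhyp : hyperfinite M.

Lemma hyperfinite_spanned (s : seq M) (e : R) : 0 < e ->
  exists (F : set M) n (v : 'I_n -> M), [/\ cstar_subalgebra F, F = spanned v
    & forall x, x \in s -> exists2 b, F b & N (x - b) < e].
Proof.
move=> e0; have [F [Falg [n [v Fv]] Fs]] := Mhyp (finite_seq s) e0.
by exists F, n, v; split=> // x xs; exact: Fs.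
Qed.

(** [p] is the unit of a subalgebra close to [s]: for [b] in it, [x - p x = (x - b) - p (x - b)]. *)
Lemma projection_approximates_seq (s : seq M) (e : R) : 0 < e ->
  exists2 p, projection p &
    forall x, x \in s -> N (x - p ** x) <= e /\ N (x - x ** p) <= e.
Proof.
move=> e0; have e2 : 0 < e / 2 by rewrite divr_gt0.
have [F [n [v [Falg Fv Fs]]]] := hyperfinite_spanned s e2.
have [p [Fp pp] pE] := subalgebra_unit Falg Fv (@tc_separated _ M).
exists p => // x /Fs[b Fb xb]; have [pb bp] := pE b Fb.
have -> : x - p ** x = (x - b) - p ** (x - b).
  by rewrite smulBr pb opprB addrA subrK.
have -> : x - x ** p = (x - b) - (x - b) ** p.
  by rewrite smulBl bp opprB addrA subrK.
have := norm2_projl (x - b) pp; have := norm2_projr (x - b) pp.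
have := ler_norm2B (x - b) (p ** (x - b)).
have := ler_norm2B (x - b) ((x - b) ** p).
by split; lra.
Qed.

Lemma trace_norm_attained tau (e : R) : X tau -> 0 < e ->
  exists2 a, rnorm a <= 1 & 1 - e < rf tau a.
Proof.
move=> Xt e0; have [lin _ n1 _] := tc_trace (tc_ax M) Xt.
pose B := [set complex.Re `|tau x| | x in [set x : M | `|x| <= 1]].
have supB : has_sup B.
  apply: contrapT => /sup_out; rewrite -/(functional_norm tau) n1 => /eqP.
  by rewrite oner_eq0.
have [_ [a a1 <-]] := sup_adherent e0 supB.
rewrite -/(functional_norm tau) n1 => ta.
have [c c1 cE] := rotate_to_norm (tau a).
exists (c *: a); last by rewrite /rf (tfZ lin) cE.
by rewrite rnormZ c1 mul1r -lecR -normE.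
Qed.

Lemma rf_projection_le1 tau p : X tau -> projection p -> rf tau p <= 1.
Proof.
by move=> Xt pp; rewrite (le_trans (rf_le_rnorm _ Xt))// rnorm_projection.
Qed.

Lemma rf_projection_ge0 tau p : X tau -> projection p -> 0 <= rf tau p.
Proof. by move=> Xt [sp pp]; rewrite -pp -{1}sp (rf_pos (tc_tracial Xt)). Qed.

(** Take [a] in the unit ball with [tau a] near 1, approximate it by a sum of products, and choose
    [p] nearly absorbing the right factors. Then [tau (a p)] is still near 1, and Cauchy-Schwarz
    bounds its square by [tau p]. *)
Lemma trace_projection tau (e : R) : X tau -> 0 < e ->
  exists2 p, projection p & 1 - e < rf tau p.
Proof.
move=> Xt e0; have T := tc_tracial Xt.
(* Four errors of size [d] occur: [e / 8] serves [(1 - 4 d)^2 >= 1 - 8 d >= 1 - e], and [1 / 8]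
   keeps [1 - 4 d] positive. *)
pose d := Num.min (e / 8) (1 / 8).
have d0 : 0 < d by rewrite lt_min divr_gt0//= divr_gt0.
have de : d <= e / 8 by rewrite ge_min lexx.
have d8 : d <= 1 / 8 by rewrite ge_min lexx orbT.
have [a a1 ta] := trace_norm_attained Xt d0.
have [s sP] := product_approximation a d0.
pose K := \sum_(uv <- s) N uv.1.
have K0 : 0 <= K by rewrite sumr_ge0// => *; exact: norm2_ge0.
have dK : 0 < d / (K + 1) by rewrite divr_gt0// ltr_wpDl.
have [p pp pP] := projection_approximates_seq [seq uv.2 | uv <- s] dK.
exists p => //.
have p1 := rnorm_projection pp.
have diffs : `|rf tau (sum_products s - sum_products s ** p)| <= d.
  rewrite /sum_products smul_suml -sumrB (rf_sum T).
  rewrite (le_trans (ler_norm_sum _ _ _))//.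
  apply: (@le_trans _ _ (\sum_(uv <- s) N uv.1 * (d / (K + 1)))).
    rewrite big_seq [leRHS]big_seq ler_sum// => uv us.
    rewrite -smulA -smulBr (le_trans (rf_norm2_inner _ _ Xt))//.
    by rewrite ler_wpM2l ?norm2_ge0// (pP _ (map_f _ us)).2.
  rewrite -mulr_suml -/K mulrCA -[leRHS]mulr1 ler_wpM2l// ?(ltW d0)//.
  by rewrite ler_pdivrMr ?mul1r ?lerDl// ltr_wpDl.
have d1 := rf_norm_le_rnorm (a - sum_products s) Xt.
have d2 := rf_norm_le_rnorm ((a - sum_products s) ** p) Xt.
have d3 : rnorm ((a - sum_products s) ** p) <= d.
  rewrite (le_trans (rnormM _ _))// (le_trans _ sP)// -[leRHS]mulr1.
  by rewrite ler_wpM2l ?rnorm_ge0.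
have tap : 1 - 4 * d < rf tau (a ** p).
  move: (le_trans d1 sP) (le_trans d2 d3) diffs; rewrite !smulBl !(rfB T) !ler_norml.
  move=> /andP[? ?] /andP[? ?] /andP[? ?]; lra.
have cs := rf_cauchy_schwarz T (star a) p.
have aa : rf tau (a ** star a) <= 1.
  rewrite (le_trans (rf_le_rnorm _ Xt))// -{1}(starK a) rnorm_starM rnorm_star.
  by rewrite exprn_ile1// rnorm_ge0.
rewrite starK in cs.
have [sp ppp] := pp; rewrite sp ppp in cs.
have tp0 := rf_projection_ge0 Xt pp.
have tp : rf tau (a ** p) ^+ 2 <= rf tau p.
  by rewrite (le_trans cs)// ler_piMl.
nra.
Qed.

(** By compactness, finitely many projections suffice to have, for each trace in [X], one of trace
    near 1. A projection [p] nearly absorbing all of them has uniformly large trace: [tau q] is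
    close to [tau (q p)], which is at most [tau p]. *)
Lemma uniform_projection (s : seq M) (e : R) : 0 < e ->
  exists p, [/\ projection p,
    forall x, x \in s -> N (x - p ** x) <= e /\ N (x - x ** p) <= e
    & forall tau, X tau -> 1 - e <= rf tau p].
Proof.
move=> e0; have e2 : 0 < e / 2 by rewrite divr_gt0.
have [l [lp lX]] : exists l : seq M, (forall p, p \in l -> projection p) /\
    forall tau, X tau -> exists2 p, p \in l & 1 - e / 2 < rf tau p.
  (* The sets of traces on which a finite list fails generate a proper filter. A limit [tau] along a
     finer ultrafilter lies in [X], but [trace_projection] gives a projection of trace above
     [1 - e / 4] at [tau], hence above [1 - e / 2] nearby. *)
  apply: contrapT => nl.
  pose D := [set l : seq M | forall p, p \in l -> projection p].
  pose B (l : seq M) := [set tau | X tau /\ forall p, p \in l -> rf tau p <= 1 - e / 2].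
  have FF : Filter (filter_from D B).
    apply: filter_from_filter; first by exists [::].
    move=> l m Dl Dm; exists (l ++ m).
      by move=> p; rewrite mem_cat => /orP[/Dl|/Dm].
    by move=> tau [Xt h]; split; split=> // p pl; apply: h; rewrite mem_cat pl ?orbT.
  have PF : ProperFilter (filter_from D B).
    apply: filter_from_proper => l Dl; apply: contrapT => /set0P/negP/negPn/eqP Bl.
    apply: nl; exists l; split=> // tau Xt; apply: contrapT => h.
    suff : B l tau by rewrite Bl.
    split=> // p pl; rewrite leNgt; apply/negP => hp; apply: h; exists p => //.
  have [U [UU FU]] := ultraFilterLemma PF.
  have XU : U [set tau | X tau].
    by apply: FU; exists [::] => // tau [].
  have [tau Xt tauP] := ultra_trace_limit (h := id) XU.
  have e4 : 0 < e / 4 by rewrite divr_gt0.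
  have [p pp tp] := trace_projection Xt e4.
  have Up : U (B [:: p]).
    by apply: FU; exists [:: p] => // q; rewrite inE => /eqP ->.
  have [t [[_ /(_ p (mem_head _ _)) tle]]] := filter_ex (filterI Up (tauP p _ e4)).
  by rewrite /= ltr_norml => /andP[? ?]; lra.
have [p pp pP] := projection_approximates_seq (s ++ l) e2.
exists p; split=> // [x xs|tau Xt].
  have xsl : x \in s ++ l by rewrite mem_cat xs.
  have [h1 h2] := pP x xsl.
  by split; lra.
have T := tc_tracial Xt.
have [q ql tq] := lX tau Xt; have [sq qq] := lp q ql; have [sp ppp] := pp.
have qsl : q \in s ++ l by rewrite mem_cat ql orbT.
have [_ h] := pP q qsl.
have := rf_projection_le T p (lp q ql).
rewrite starM sq sp -smulA (smulA q) qq ppp (rf_comm T) -smulA ppp.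
have := rf_norm2_inner q (q - q ** p) Xt.
rewrite smulBr (smulA q q) qq (rfB T) ler_norml => /andP[_].
have := norm2_proj (lp q ql); have := norm2_ge0 q; have := norm2_ge0 (q - q ** p).
by nra.
Qed.

(** The square of [p - q] has trace [tau p + tau q - 2 tau (p q)], where [tau (q - p q) <= d] and
    [tau p - tau q <= e]. *)
Lemma norm2_projection_dist p q (e d : R) : projection p -> projection q ->
  (forall tau, X tau -> 1 - e <= rf tau q) -> N (q - p ** q) <= d -> 0 <= e ->
  N (p - q) <= Num.sqrt (e + 2 * d).
Proof.
move=> pp qq qe pq e0; have d0 := le_trans (norm2_ge0 _) pq.
apply: norm2_le_rf; first exact: sqrtr_ge0.
move=> tau Xt; have T := tc_tracial Xt.
rewrite sqr_sqrtr; last lra.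
have [sp ppp] := pp; have [sq qqq] := qq.
rewrite starB sp sq smulBr !smulBl ppp qqq !(rfB T) (rf_comm T q p).
have := rf_norm2_inner (q - p ** q) q Xt.
rewrite smulBl -smulA qqq (rfB T) ler_norml => /andP[_].
have := norm2_proj qq; have := norm2_ge0 q; have := norm2_ge0 (q - p ** q).
have := rf_projection_le1 Xt pp; have := qe _ Xt; nra.
Qed.

Lemma exists_identity : exists u : M, [/\ is_identity u, projection u
  & forall tau, X tau -> rf tau u = 1].
Proof.
(* With [c n = 1 / (n + 1)], a tolerance of a third of its square for both errors turns the bound
   [sqrt (e + 2 d)] of [norm2_projection_dist] into [c n]. *)
have d0 n : 0 < (n.+1%:R)^-1 ^+ 2 / 3 :> R.
  by rewrite divr_gt0// exprn_gt0// invr_gt0.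
have /(_ _)/cid-/all_sig[p pP] n := uniform_projection [::] (d0 n).
have pp n : projection (p n) by case: (pP n).
pose c n : R := n.+1%:R^-1.
have c0 n : 0 < c n by rewrite invr_gt0.
(* [p m] and [p n] are compared through a projection [f] nearly above both; absorbing [s] as well is
   what shows that the limit acts as a unit. *)
have near m n (s : seq M) (e : R) : 0 < e -> exists f, [/\ projection f,
    forall x, x \in s -> N (x - f ** x) <= e,
    N (f - p m) <= c m & N (f - p n) <= c n].
  move=> e0; pose d := Num.min e (Num.min (c m ^+ 2 / 3) (c n ^+ 2 / 3)).
  have dP : 0 < d by rewrite !lt_min e0 !d0.
  have [f [fp fs _]] := uniform_projection (p m :: p n :: s) dP.
  have de : d <= e by rewrite ge_min lexx.
  have dm : d <= c m ^+ 2 / 3 by rewrite /d !ge_min lexx orbT.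
  have dn : d <= c n ^+ 2 / 3 by rewrite /d !ge_min lexx !orbT.
  have fk k : d <= c k ^+ 2 / 3 -> p k \in p m :: p n :: s -> N (f - p k) <= c k.
    move=> dk /fs[h _]; have [_ _ pt] := pP k.
    rewrite (le_trans (norm2_projection_dist fp (pp k) pt h (ltW (d0 k))))//.
    rewrite -[leRHS]ger0_norm ?(ltW (c0 k))// -sqrtr_sqr ler_wsqrtr//.
    by rewrite -/(c k); move: (c k ^+ 2) dk => r; lra.
  exists f; split.
  - by [].
  - move=> x xs; have xsp : x \in p m :: p n :: s by rewrite !inE xs !orbT.
    by have [h _] := fs x xsp; exact: le_trans h de.
  - by apply: fk => //; rewrite mem_head.
  - by apply: fk => //; rewrite !inE eqxx orbT.
have small (e : R) : 0 < e -> exists n0 : nat, forall n, (n0 <= n)%N -> c n < e.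
  by move=> e0; have [n0 _ n0P] := near_infty_natSinv_lt (PosNum e0); exists n0.
have p1 n : rnorm (p n) <= 1 by exact: rnorm_projection.
have [e e0|u u1 pu] := norm2_ball_complete p1.
  have e2 : 0 < e / 2 by rewrite divr_gt0.
  have [n0 n0P] := small _ e2; exists n0 => m n nm nn.
  have [f [_ _ fm fn]] := near m n [::] 1 ltr01.
  have := ler_norm2_dist (p m) f (p n); rewrite (norm2_distC (p m) f).
  have := n0P m nm; have := n0P n nn; lra.
have su : star u = u.
  have sp n : star (p n) = p n by case: (pp n).
  apply: (norm2_cvg_unique (norm2_cvg_star pu)).
  by under eq_fun do rewrite sp.
have ux x : u ** x = x.
  apply: (norm2_cvg_unique (norm2_cvg_mulr x p1 pu)) => e e0.
  have e2 : 0 < e / 2 by rewrite divr_gt0.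
  have [d dpos dP] := norm2_small_mulr M (rnorm x) 2 e2.
  have [n0 n0P] := small _ dpos; exists n0 => n nn.
  have [f [pf fx fn _]] := near n n [:: x] _ e2.
  have := ler_norm2_dist (p n ** x) (f ** x) x.
  rewrite -smulBl (norm2_distC (f ** x)).
  have := fx x (mem_head _ _).
  have : N ((p n - f) ** x) <= e / 2.
    apply: dP => //.
      rewrite (le_trans (ler_rnormB _ _))//.
      by have := p1 n; have := rnorm_projection pf; lra.
    by rewrite norm2_distC (le_trans fn)// ltW// n0P.
  lra.
have xu x : x ** u = x by rewrite -(starK (x ** u)) starM su ux starK.
have pju : projection u by split.
exists u; split=> // tau Xt; apply/eqP; rewrite eq_le.
rewrite rf_projection_le1//= leNgt; apply/negP => tu.
(* If [tau u < 1], some projection [q] has [tau q > tau u], although [q] lies below the unit. *)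
have e0 : 0 < 1 - rf tau u by lra.
have [q qq tq] := trace_projection Xt e0.
have := rf_projection_le (tc_tracial Xt) u qq.
by rewrite xu su ux; case: qq => -> ->; lra.
Qed.

End unit.

(** * Almost central projections *)

Section partition.
Context {R : realType} (M : tcAlgType R).
Local Notation C := (R[i]^o).
Local Notation X := (@tc_traces R M).
Local Notation N := (norm2 X).
Implicit Types x y z : M.
Hypothesis Mhyp : hyperfinite M.
Variables (u : M) (u1 : is_identity u) (pu : projection u).

Let ux x : u ** x = x. Proof. by case: (u1 x). Qed.
Let xu x : x ** u = x. Proof. by case: (u1 x). Qed.
Let su : star u = u. Proof. by case: pu. Qed.

(** [h] is the self-adjoint part of [b]; since [N] is invariant under [star], it is as close to [a]
    as [b] is. *)
Lemma self_adjoint_approximation (F : set M) a b (d : R) : cstar_subalgebra F ->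
  F b -> star a = a -> N (a - b) < d ->
  exists2 h, F h /\ star h = h & N (a - h) <= d.
Proof.
move=> [F0 Flin _ Fs _] Fb sa ab; pose h := ((2^-1)%:C)%C *: (b + star b).
exists h.
  split; last by rewrite starZ conjcR starD starK addrC.
  rewrite /h -[_ *: _]addr0; apply: (Flin) => //; rewrite -[X in X + _]scale1r.
  by apply: Flin => //; exact: Fs.
have -> : a - h = ((2^-1)%:C)%C *: ((a - b) + star (a - b)).
  rewrite starB sa addrACA -opprD scalerBr; congr (_ - _).
  rewrite scalerDr -scalerDl.
  have -> : ((2^-1)%:C)%C + ((2^-1)%:C)%C = 1 :> R[i].
    by rewrite -[RHS]half_double mulrDr !mulr1.
  by rewrite scale1r.
rewrite norm2Zr ger0_norm ?invr_ge0//.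
by have := ler_norm2D (a - b) (star (a - b)); rewrite norm2_starE; lra.
Qed.

Lemma central_commutator (F : set M) z x b (d : R) : projection z -> central_in F z ->
  F b -> N (x - b) < d -> N (z ** x - x ** z) <= 2 * d.
Proof.
move=> pz cz Fb xb.
have -> : z ** x - x ** z = z ** (x - b) - (x - b) ** z.
  by rewrite smulBr smulBl (cz b Fb) opprB addrA subrK.
have := ler_norm2B (z ** (x - b)) ((x - b) ** z).
have := norm2_projl (x - b) pz; have := norm2_projr (x - b) pz; lra.
Qed.

(** [sign_partition] is applied in a subalgebra [F] to [h i - delta e], with [h i] in [F] near
    [a i]. The unit [e] of [F] may differ from [u]; the gap [u - e], small in [N], is added to the
    remainder. *)
Lemma near_partition (a : nat -> M) (m : nat) (delta : R) (s : seq M) (eta : R) :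
  (forall i, star (a i) = a i) -> 0 < eta ->
  exists (p : nat -> M) (q : M),
  [/\ (forall i, projection (p i)) /\ projection q,
      forall i j, (i < j < m)%N -> p i ** p j = 0 /\ p j ** p i = 0,
      (forall i, (i < m)%N -> p i ** q = 0 /\ q ** p i = 0) /\
        \sum_(i < m) p i + q = u,
      (forall x i, x \in s -> N (p i ** x - x ** p i) <= eta) /\
        (forall x, x \in s -> N (q ** x - x ** q) <= eta)
    & forall tau i, X tau -> (i < m)%N ->
        rf tau (a i ** p i) <= delta * rf tau (p i) + eta /\
        delta * rf tau q - eta <= rf tau (a i ** q)].
Proof.
move=> sa eta0.
pose K := \sum_(i < m) N (a i) + `|delta|.
have K0 : 0 <= K by rewrite addr_ge0// sumr_ge0// => *; exact: norm2_ge0.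
(* The commutators of the remainder cost [4 d]; its trace estimates cost [d] for replacing [a i] by
   [h i] and at most [2 d K] for the gap [u - e]. *)
pose d := eta / (4 + 2 * K).
have T0 : 0 < 4 + 2 * K by lra.
have d0 : 0 < d by rewrite divr_gt0.
have dE : d * (4 + 2 * K) = eta by rewrite /d divfK// gt_eqF.
have dK : 0 <= d * K by rewrite mulr_ge0// ltW.
have [F [n [v [Falg Fv Fs]]]] :=
  hyperfinite_spanned Mhyp (u :: s ++ [seq a i | i <- iota 0 m]) d0.
have [e [Fe pe] eE] := subalgebra_unit Falg Fv (@tc_separated _ M).
have [F0 Flin _ _ _] := Falg.
have /(_ _)/cid-/all_sig[h hP] i : exists h,
    [/\ F h, star h = h & (i < m)%N -> N (a i - h) <= d].
  have [im|im] := ltnP i m; last by exists 0; rewrite star0.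
  have [|b Fb ab] := Fs (a i).
    by rewrite inE mem_cat map_f ?orbT// mem_iota.
  by have [h [Fh sh] ah] := self_adjoint_approximation Falg Fb (sa i) ab; exists h.
pose c i := h i - (delta%:C)%C *: e.
have Fc i : F (c i).
  rewrite /c addrC -scaleNr; apply: Flin => //; first by case: (hP i).
have se : star e = e by case: pe.
have sc i : star (c i) = c i.
  by rewrite /c starB starZ conjcR se; have [_ -> _] := hP i.
have [p [q [pP qP pp [pq pqe] pcq]]] :=
  sign_partition Falg Fv (@tc_separated _ M) m Fe pe eE Fc sc.
pose q' := q + (u - e).
have Fp i : F (p i) by case: (pP i).
have [Fq [sq qq] cq] := qP.
have eu : projection (u - e).
  split; first by rewrite starB su se.
  rewrite smulBl ux smulBr xu; have [_ ->] := pe.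
  by rewrite subrr subr0.
have yeu y : F y -> y ** (u - e) = 0 /\ (u - e) ** y = 0.
  by move=> Fy; rewrite smulBl smulBr ux xu (eE _ Fy).1 (eE _ Fy).2 subrr.
have pq' : projection q'.
  split; first by rewrite starD sq; case: eu => ->.
  have [qf fq] := yeu q Fq; have [_ ff] := eu; rewrite /q'.
  by move: (u - e) qf fq ff => f qf fq ff; rewrite smulDl !smulDr qq qf fq ff addr0 add0r.
have ue : N (u - e) <= 2 * d.
  have [b Fb ub] := Fs u (mem_head _ _).
  have -> : u - e = (u - b) - e ** (u - b).
    by rewrite smulBr xu (eE _ Fb).1 opprB addrA subrK.
  have := norm2_projl (u - b) pe; have := ler_norm2B (u - b) (e ** (u - b)); lra.
have comm z x : central_projection F z -> x \in s -> N (z ** x - x ** z) <= 2 * d.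
  move=> [_ pz cz] xs; have [|b Fb xb] := Fs x.
    by rewrite inE mem_cat xs orbT.
  exact: central_commutator pz cz Fb xb.
have ce : central_projection F e by split=> // y Fy; rewrite !(eE _ Fy).1 (eE _ Fy).2.
exists p, q'; split.
- by split=> // i; case: (pP i).
- exact: pp.
- split=> [i im|].
    rewrite /q' smulDl smulDr (yeu _ (Fp i)).1 (yeu _ (Fp i)).2 !addr0.
    exact: pq.
  by rewrite /q' addrA pqe addrC subrK.
- split=> [x i xs|x xs].
    by have := comm _ _ (pP i) xs; lra.
  have -> : q' ** x - x ** q' = (q ** x - x ** q) - (e ** x - x ** e).
    rewrite /q' smulDl smulDr smulBl smulBr ux xu opprD addrACA; congr (_ + _).
    by rewrite opprB addrC addrA subrK opprB.
  have := ler_norm2B (q ** x - x ** q) (e ** x - x ** e).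
  have := comm _ _ qP xs; have := comm _ _ ce xs; lra.
- move=> tau i Xt im; have T := tc_tracial Xt.
  have /andP[cp cqi] := pcq tau i T im.
  have [Fh sh /(_ im) ah] := hP i.
  have bound z : projection z -> `|rf tau ((a i - h i) ** z)| <= d.
    move=> pz; rewrite (le_trans (rf_norm2_inner _ _ Xt))//.
    rewrite (le_trans _ ah)// -[leRHS]mulr1 ler_wpM2l ?norm2_ge0//.
    exact: norm2_proj.
  move: cp cqi; rewrite !smulBl !smulZl !(eE _ _).1// !(rfB T) !(rfZ T) => cp cqi.
  split.
    have [_ ppi _] := pP i; have := bound _ ppi.
    rewrite smulBl (rfB T) ler_norml => /andP[_ h2]; lra.
  have bq := bound q (conj sq qq).
  move: bq; rewrite smulBl (rfB T) ler_norml => /andP[h2 _].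
  rewrite /q' smulDr (rfD T q) (rfD T (a i ** q)).
  have := rf_norm2_inner (a i) (u - e) Xt; rewrite ler_norml => /andP[h3 _].
  have := rf_norm2_inner u (u - e) Xt; rewrite ux ler_norml => /andP[h4 h4'].
  have aK : N (a i) + `|delta| <= K.
    rewrite lerD2r (bigD1 (Ordinal im))//= lerDl sumr_ge0// => *.
    exact: norm2_ge0.
  have nu : N u * N (u - e) <= 2 * d.
    by rewrite -[leRHS]mul1r ler_pM ?norm2_ge0// norm2_proj.
  have na : N (a i) * N (u - e) <= N (a i) * (2 * d).
    by rewrite ler_wpM2l// norm2_ge0.
  have h5 : delta * rf tau (u - e) <= `|delta| * (2 * d).
    rewrite (le_trans (ler_norm _))// normrM ler_wpM2l// ler_norml.
    by apply/andP; split; lra.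
  have h6 : d * (N (a i) + `|delta|) <= d * K by rewrite ler_wpM2l// ltW.
  lra.
Qed.
End partition.

(** * Smallness of the remainder *)

Section ultralimit_calculus.
Context {R : realType} (T : Type) (U : set_system T) {UU : UltraFilter U}.
Implicit Types f g : T -> R.

Definition ulim f (x : R) := forall e : R, 0 < e -> U [set t | `|f t - x| < e].

Lemma ulimD f g x y : ulim f x -> ulim g y -> ulim (fun t => f t + g t) (x + y).
Proof.
move=> fx gy e e0; have e2 : 0 < e / 2 by rewrite divr_gt0.
apply: filterS2 (fx _ e2) (gy _ e2) => t /= h1 h2.
by rewrite opprD addrACA (le_lt_trans (ler_normD _ _))//; lra.
Qed.

Lemma ulimZ f x (k : R) : ulim f x -> ulim (fun t => k * f t) (k * x).
Proof.
move=> fx e e0; have k0 : 0 < `|k| + 1 by rewrite ltr_wpDl.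
have d0 : 0 < e / (`|k| + 1) by rewrite divr_gt0.
apply: filterS (fx _ d0) => t /=; rewrite ltr_pdivlMr// => h.
rewrite -mulrBr normrM; have := normr_ge0 (f t - x); nra.
Qed.

Lemma ulim_cst (x : R) : ulim (fun=> x) x.
Proof. by move=> e e0; apply: filterS filterT => t _ /=; rewrite subrr normr0. Qed.

Lemma ulim_le f g x y : ulim f x -> ulim g y ->
  (forall e : R, 0 < e -> U [set t | f t <= g t + e]) -> x <= y.
Proof.
move=> fx gy fg; rewrite leNgt; apply/negP => yx.
have e0 : 0 < (x - y) / 4 by rewrite divr_gt0// subr_gt0.
have := filter_ex (filterI (filterI (fx _ e0) (gy _ e0)) (fg _ e0)).
by move=> [t [[/= +] ]]; rewrite !ltr_norml => /andP[? ?] /andP[? ?] ?; lra.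
Qed.

Lemma ulim_eq f g x y : ulim f x -> ulim g y ->
  (forall e : R, 0 < e -> U [set t | `|f t - g t| <= e]) -> x = y.
Proof.
move=> fx gy fg; apply/eqP; rewrite eq_le; apply/andP; split.
- apply: (ulim_le fx gy) => e /fg; apply: filterS => t /=.
  by rewrite ler_norml => /andP[? ?]; lra.
- apply: (ulim_le gy fx) => e /fg; apply: filterS => t /=.
  by rewrite ler_norml => /andP[? ?]; lra.
Qed.

End ultralimit_calculus.

(** * Functionals and their real parts *)

Section real_parts.
Context {R : realType} {A : cstarAlgType R}.
Local Notation C := (R[i]^o).
Implicit Types (f : A -> C) (L : A -> R).

(** A complex linear functional is recovered from its real part by [f a = L a - i L (i a)], so
    limits need only be taken of real functions. *)
Definition of_real_part L : A -> C := fun a => Complex (L a) (- L (('i)%C *: a)).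

Lemma linear_of_real_part f : linear f -> f = of_real_part (rf f).
Proof.
move=> lin; apply/funext => a; rewrite /of_real_part /rf (tfZ lin).
by case: (f a) => x y /=; rewrite mul0r mul1r sub0r opprK.
Qed.

(** [trp_im] makes the complex functional real on squares, as positivity in [R[i]] demands. *)
Record tracial_real_part L : Prop := {
  trp_add : forall a b, L (a + b) = L a + L b;
  trp_scale : forall (r : R) a, L ((r%:C)%C *: a) = r * L a;
  trp_pos : forall a, 0 <= L (star a ** a);
  trp_im : forall a, L (('i)%C *: (star a ** a)) = 0;
  trp_comm : forall a b, L (a ** b) = L (b ** a)
}.

Lemma of_real_part_tracial L : tracial_real_part L ->
  tracial_functional (of_real_part L).
Proof.
move=> [LD LZ Lp Li Lc]; have cE (c : R[i]) (a : A) :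
    c *: a = ((complex.Re c)%:C)%C *: a + ((complex.Im c)%:C)%C *: (('i)%C *: a).
  rewrite scalerA -scalerDl {1}[c]complexE; congr (_ *: _).
  by rewrite mulrC.
have Lii (a : A) : L (('i)%C *: (('i)%C *: a)) = - L a.
  rewrite scalerA iR_sqr (_ : -1 = ((-1)%:C)%C :> R[i]) ?LZ ?mulN1r//.
  by rewrite rmorphN rmorph1.
split=> [c a b|a|a b].
- rewrite /of_real_part scalerDr !LD (scalerA _ c) (mulrC _ c) -scalerA.
  rewrite !(cE c) !LD !LZ Lii.
  by case: c => x y /=; apply/eqP; rewrite eq_complex /=; apply/andP; split; apply/eqP; ring.
- by rewrite /of_real_part Li oppr0 lecE /= eqxx Lp.
- by rewrite /of_real_part Lc -smulZl (Lc (_ *: a)) smulZr.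
Qed.

Lemma rf_tracial_real_part f : tracial_functional f -> tracial_real_part (rf f).
Proof.
move=> F; split=> *; rewrite ?(rfD F) ?(rfZ F) ?(rf_pos F)//.
- by rewrite /rf (tfZ (tf_linear F)) (tf_square F) Re_iM /= oppr0.
- exact: rf_comm.
Qed.

(** On the unit ball, Cauchy-Schwarz against the unit bounds the square of [|f a|] by [S], so
    [S^2 <= S]. The bound by [K] guarantees that [S] is the supremum of a bounded set. *)
Lemma trace_of_state f (u : A) (K : R) : tracial_functional f -> is_identity u ->
  projection u -> rf f u = 1 -> (forall a, rf f a <= K * rnorm a) -> trace f.
Proof.
move=> F u1 [su uu] fu fK; split; [exact: tf_linear|exact: tf_pos| |exact: tf_comm].
set S := functional_norm f.
have rot (a : A) : exists c : R[i], `|c| = 1 /\ complex.Re `|f a| = rf f (c *: a).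
  have [c c1 cE] := rotate_to_norm (f a); exists c; split=> //.
  by rewrite /rf (tfZ (tf_linear F)) cE.
pose B := [set complex.Re `|f a| | a in [set a : A | `|a| <= 1]].
have nu : rnorm u <= 1 by apply: rnorm_projection.
have supB : has_sup B.
  split; first by exists (complex.Re `|f 0|), 0; rewrite //= normr0.
  exists `|K| => _ [a /= a1 <-]; have [c [c1 cE]] := rot a.
  suff h : rf f (c *: a) <= `|K| by rewrite -cE in h.
  rewrite (le_trans (fK _))// rnormZ c1 mul1r (le_trans (ler_norm _))// normrM.
  rewrite (ger0_norm (rnorm_ge0 a)) -[leRHS]mulr1 ler_wpM2l//.
  by rewrite -lecR -normE.
have BS (a : A) : rnorm a <= 1 -> complex.Re `|f a| <= S.
  by move=> a1; apply: (ub_le_sup supB.2); exists a; rewrite //= normE lecR.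
have S1 : 1 <= S by rewrite -fu (le_trans (Re_le_norm _))// BS.
apply/eqP; rewrite eq_le S1 andbT.
have S0 : 0 <= S by lra.
suff SS : S <= Num.sqrt S.
  have : S ^+ 2 <= S by rewrite -[leRHS]sqr_sqrtr// lerXn2r ?nnegrE ?sqrtr_ge0.
  nra.
apply: ge_sup; first exact: supB.1.
move=> _ [a /= a1 <-]; have [c [c1 cE]] := rot a.
have ca1 : rnorm (c *: a) <= 1 by rewrite rnormZ c1 mul1r -lecR -normE.
have f0 : 0 <= complex.Re `|f a| by exact: Re_ge0.
suff : complex.Re `|f a| <= Num.sqrt S by [].
rewrite -(ger0_norm f0) -sqrtr_sqr ler_wsqrtr// cE.
have := rf_cauchy_schwarz F u (c *: a).
rewrite su uu fu mul1r (proj1 (u1 _)) => h; rewrite (le_trans h)//.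
by rewrite (le_trans (Re_le_norm _))// BS// rnorm_starM exprn_ile1// rnorm_ge0.
Qed.

End real_parts.

Section small_remainder.
Context {R : realType} (M : tcAlgType R).
Local Notation C := (R[i]^o).
Local Notation X := (@tc_traces R M).
Local Notation N := (norm2 X).
Implicit Types x y z : M.
Hypothesis Mfac : tc_factorial M.
Variables (u : M) (u1 : is_identity u) (pu : projection u).
Hypothesis tu : forall tau, X tau -> rf tau u = 1.

Let ux x : u ** x = x. Proof. by case: (u1 x). Qed.
Let xu x : x ** u = x. Proof. by case: (u1 x). Qed.

(** Positivity of [tau (q .)] for a projection [q] that need not be central: the trace property
    moves one copy of [q] to the other end. *)
Lemma corner_square tau q x : tracial_functional tau -> projection q ->
  tau (q ** (star x ** x)) = tau (star (x ** q) ** (x ** q)).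
Proof.
move=> T [sq qq]; rewrite starM sq -{1}qq -smulA (tf_comm T q).
by rewrite !smulA.
Qed.

Lemma corner_le tau q x : tracial_functional tau -> projection q ->
  rf tau (q ** (star x ** x)) <= rf tau (star x ** x).
Proof.
move=> T pq; rewrite /rf (corner_square _ T pq) (tf_comm T) -{1}(starK (x ** q)).
rewrite -[complex.Re _]/(rf tau _) starM (_ : star q = q); last by case: pq.
rewrite (le_trans (rf_projection_le T _ pq))// starK.
by rewrite /rf (tf_comm T).
Qed.

Lemma small_remainder (a : nat -> M) (m : nat) (delta eps : R) :
  (forall tau, X tau -> exists2 i, (i < m)%N & rf tau (a i) < delta) ->
  0 < eps ->
  exists (s : seq M) (eta : R), 0 < eta /\
    forall q tau, projection q -> (forall x, x \in s -> N (q ** x - x ** q) <= eta) ->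
    X tau ->
    (forall i, (i < m)%N -> delta * rf tau q - eta <= rf tau (a i ** q)) ->
    rf tau q <= eps.
Proof.
move=> aX eps0; apply: contrapT => /forallNP nex.
pose D := [set i : seq M * R | 0 < i.2].
(* [B i] is the set of counterexamples [(q, tau)] for the data [i]; these sets form a filter base,
   and all limits below are along an ultrafilter containing them. *)
pose B (i : seq M * R) := [set t : M * (M -> C) | [/\ projection t.1,
  forall x, x \in i.1 -> N (t.1 ** x - x ** t.1) <= i.2, X t.2,
  forall j, (j < m)%N -> delta * rf t.2 t.1 - i.2 <= rf t.2 (a j ** t.1)
  & eps < rf t.2 t.1]].
have FF : Filter (filter_from D B).
  apply: filter_from_filter; first by exists ([::], 1); rewrite /D /=.
  move=> [s e] [s' e'] /= e0 e0'; exists (s ++ s', Num.min e e').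
    by rewrite /D /= lt_min e0.
  have m1 : Num.min e e' <= e by rewrite ge_min lexx.
  have m2 : Num.min e e' <= e' by rewrite ge_min lexx orbT.
  move=> [q tau] [/= pq com Xt aq tq]; split; split=> //= [x xs|j jm].
  - by rewrite (le_trans (com x _))// mem_cat xs.
  - by rewrite (le_trans _ (aq j jm))// lerB.
  - by rewrite (le_trans (com x _))// mem_cat xs orbT.
  - by rewrite (le_trans _ (aq j jm))// lerB.
have PF : ProperFilter (filter_from D B).
  apply: filter_from_proper => -[s e] /= e0; apply: contrapT => nB.
  have /forallNP/(_ e)/not_andP[//|] := nex s; apply => q tau pq com Xt aq.
  rewrite leNgt; apply/negP => tq; apply: nB.
  by exists (q, tau).
have [U [UU FU]] := ultraFilterLemma PF.
have UB s e : 0 < e -> U (B (s, e)) by move=> e0; apply: FU; exists (s, e).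
have UX : U [set t | X t.2] by apply: filterS (UB [::] 1 ltr01) => t [].
have Up : U [set t | projection t.1] by apply: filterS (UB [::] 1 ltr01) => t [].
have UXp : U [set t | X t.2 /\ projection t.1] by exact: filterI.
have [tau Xt tauP] := ultra_trace_limit UX.
have T := tc_tracial Xt.
have /(_ _)/cid-/all_sig[L LP] x : exists l, ulim U (fun t => rf t.2 (t.1 ** x)) l.
  apply: (@ultra_bounded_limit _ _ _ _ _ (rnorm x)).
  apply: filterS UXp => t [Xt2 pt] /=; rewrite (le_trans (rf_norm_le_rnorm _ Xt2))//.
  rewrite (le_trans (rnormM _ _))// -[leRHS]mul1r ler_wpM2r ?rnorm_ge0//.
  exact: rnorm_projection.
have ucst (r : R) : ulim U (fun=> r) r by exact: ulim_cst.
have Ltr : tracial_real_part L.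
  split=> [x y|r x|x|x|x y].
  - apply: (ulim_eq (LP _) (ulimD (LP x) (LP y))) => e e0.
    apply: filterS UX => t /= /tc_tracial Tt.
    by rewrite smulDr (rfD Tt) subrr normr0 ltW.
  - apply: (ulim_eq (LP _) (ulimZ r (LP x))) => e e0.
    apply: filterS UX => t /= /tc_tracial Tt.
    by rewrite smulZr (rfZ Tt) subrr normr0 ltW.
  - apply: (ulim_le (ucst 0) (LP _)) => e e0.
    apply: filterS UXp => t /= [/tc_tracial Tt pt].
    rewrite /rf (corner_square _ Tt pt) addr_ge0 ?(ltW e0)//.
    exact: rf_pos.
  - apply: (ulim_eq (LP _) (ucst 0)) => e e0.
    apply: filterS UXp => t /= [/tc_tracial Tt pt].
    rewrite smulZr /rf (tfZ (tf_linear Tt)) (corner_square _ Tt pt) (tf_square Tt).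
    by rewrite Re_iM /= oppr0 addr0 normr0 ltW.
  (* Almost centrality enters here: [tau (q x y) - tau (q y x) = tau ((q x - x q) y)]. *)
  - apply: (ulim_eq (LP _) (LP _)) => e e0.
    have d0 : 0 < e / (N y + 1) by rewrite divr_gt0// ltr_wpDl// norm2_ge0.
    apply: filterS (UB [:: x] _ d0) => t /= [pt /(_ x (mem_head _ _)) com Xt2 _ _].
    have Tt := tc_tracial Xt2.
    rewrite smulA (smulA _ y) (rf_comm Tt (_ ** y)) smulA -(rfB Tt) -smulBl.
    rewrite (le_trans (rf_norm2_inner _ _ Xt2))//.
    have y1 : 0 < N y + 1 by rewrite ltr_wpDl// norm2_ge0.
    move: com; rewrite ler_pdivlMr// => com.
    have := norm2_ge0 y; have := norm2_ge0 (t.1 ** x - x ** t.1); nra.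
have [LD LZ Lpos Lim Lcomm] := Ltr.
have Lle x : L (star x ** x) <= rf tau (star x ** x).
  apply: (ulim_le (LP _) (tauP _)) => e e0.
  apply: filterS UXp => t /= [/tc_tracial Tt pt].
  by rewrite (le_trans (corner_le _ Tt pt))// lerDl ltW.
have Lnorm x : L x <= rnorm x.
  apply: (ulim_le (LP _) (ucst _)) => e e0.
  apply: filterS UXp => t /= [Xt2 pt].
  rewrite (le_trans (rf_le_rnorm _ Xt2))// (le_trans (rnormM _ _))//.
  rewrite (le_trans _ (_ : rnorm x <= _)) ?lerDl ?(ltW e0)//.
  by rewrite -[leRHS]mul1r ler_wpM2r ?rnorm_ge0// rnorm_projection.
have Lu : eps <= L u.
  apply: (ulim_le (ucst _) (LP _)) => e e0.
  apply: filterS (UB [::] 1 ltr01) => t [_ _ _ _ h] /=.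
  by rewrite xu; lra.
have Lu1 : L u <= 1 by rewrite (le_trans (Lnorm _))// rnorm_projection.
have La i : (i < m)%N -> delta * L u <= L (a i).
  move=> im; apply: (ulim_le (ulimZ _ (LP _)) (LP _)) => e e0.
  apply: filterS (UB [::] _ e0) => t [_ _ Xt2 /(_ i im) /= h _] /=.
  by rewrite xu (rf_comm (tc_tracial Xt2)); lra.
have Lu0 : 0 < L u by lra.
pose L1 x := (L u)^-1 * L x.
(* [tau] is split as [t L1 + (1 - t) L2], where [t L1] is [L / 2]. The half keeps [t < 1] even if
   [L u = 1], and [L2] is positive because [L] is dominated by [tau] on squares. *)
pose t := L u / 2; have t01 : 0 < t < 1 by rewrite /t; apply/andP; split; lra.
have t1 : 0 < 1 - t by case/andP: t01; lra.
pose L2 x := (1 - t)^-1 * (rf tau x - 2^-1 * L x).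
have L1tr : tracial_real_part L1.
  split=> [x y|r x|x|x|x y]; rewrite /L1.
  - by rewrite LD mulrDr.
  - by rewrite LZ mulrCA.
  - by rewrite mulr_ge0// invr_ge0 ltW.
  - by rewrite Lim mulr0.
  - by rewrite Lcomm.
have [tD tZ tpos tim tcomm] := rf_tracial_real_part T.
have L2tr : tracial_real_part L2.
  split=> [x y|r x|x|x|x y]; rewrite /L2.
  - by rewrite LD tD; ring.
  - by rewrite LZ tZ; ring.
  - rewrite mulr_ge0 ?invr_ge0 ?(ltW t1)//.
    by have := Lle x; have := Lpos x; lra.
  - by rewrite Lim tim mulr0 subr0 mulr0.
  - by rewrite Lcomm tcomm.
have LN x : - rnorm x <= L x.
  have := Lnorm (- x); rewrite rnormN.
  rewrite (_ : - x = ((-1)%:C)%C *: x) ?LZ; first lra.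
  by rewrite rmorphN rmorph1 scaleN1r.
have tr1 : trace (of_real_part L1).
  apply: (trace_of_state (K := (L u)^-1) (of_real_part_tracial L1tr) u1 pu).
    by rewrite /rf /= /L1 mulVf// gt_eqF.
  by move=> x; rewrite /rf /= ler_wpM2l// invr_ge0 ltW.
have tr2 : trace (of_real_part L2).
  apply: (trace_of_state (K := (1 - t)^-1 * 2) (of_real_part_tracial L2tr) u1 pu).
    by rewrite /rf /= /L2 tu// /t mulrC -[_ * L u]mulrC mulfV// gt_eqF.
  move=> x; rewrite /rf /= /L2 -mulrA ler_wpM2l ?invr_ge0 ?(ltW t1)//.
  have := LN x; have := rf_le_rnorm x Xt; have := rnorm_ge0 x; lra.
have [[_ _ Xface] _] := Mfac.
have [X1 _] : X (of_real_part L1) /\ X (of_real_part L2).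
  apply: (Xface _ _ ((t%:C)%C) tr1 tr2); first by rewrite !ltcR.
  suff <- : tau = (t%:C)%C *: of_real_part L1 + (1 - (t%:C)%C) *: of_real_part L2 by [].
  rewrite (linear_of_real_part (tf_linear T)); apply/funext => x /=.
  have LE y : rf tau y = t * L1 y + (1 - t) * L2 y.
    by rewrite /L1 /L2 mulrA mulVKf ?gt_eqF// /t; field; rewrite gt_eqF.
  transitivity ((t%:C)%C * of_real_part L1 x + (1 - (t%:C)%C) * of_real_part L2 x);
    last by [].
  have -> : 1 - (t%:C)%C = ((1 - t)%:C)%C :> R[i] by rewrite rmorphB rmorph1.
  apply/eqP; rewrite /of_real_part !LE eq_complex /=.
  by apply/andP; split; apply/eqP; ring.
have [i im] := aX _ X1; rewrite /rf /= /L1 mulrC ltr_pdivrMr// => h.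
by have := La i im; lra.
Qed.
End small_remainder.

(** * Partitions of unity in M *)

Section local_partition.
Context {R : realType} (M : tcAlgType R).
Local Notation C := (R[i]^o).
Local Notation X := (@tc_traces R M).
Local Notation N := (norm2 X).
Implicit Types x y z : M.
Hypotheses (Mhyp : hyperfinite M) (Mfac : tc_factorial M).
Variables (u : M) (u1 : is_identity u) (pu : projection u).
Hypothesis tu : forall tau, X tau -> rf tau u = 1.

(** The remainder of [near_partition] is added to the first projection: the sum becomes exactly [u],
    and smallness of the remainder in [N] keeps the trace estimate. *)
Lemma local_partition (a : nat -> M) (k : nat) (delta : R) (s : seq M) (eps : R) :
  (forall i, star (a i) = a i) ->
  (forall tau, X tau -> exists2 i, (i < k.+1)%N & rf tau (a i) < delta) ->
  0 < eps ->
  exists p : nat -> M,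
  [/\ forall i, projection (p i),
      forall i j, (i < k.+1)%N -> (j < k.+1)%N -> i != j -> p i ** p j = 0,
      \sum_(i < k.+1) p i = u,
      forall x i, x \in s -> N (p i ** x - x ** p i) <= eps
    & forall tau i, X tau -> (i < k.+1)%N ->
        rf tau (a i ** p i) <= delta * rf tau (p i) + eps].
Proof.
move=> sa aX eps0.
(* With [tau q <= r^2] one has [N q <= r], and [r <= 1] gives [tau q <= r]; adding [q] then costs at
   most [r (N (a 0) + |delta|)], which is below [eps / 2]. *)
pose K := N (a 0) + `|delta| + 1.
have K0 : 1 <= K by rewrite lerDr addr_ge0// norm2_ge0.
pose r := Num.min 1 (eps / (2 * K)).
have Kp : 0 < 2 * K by lra.
have r0 : 0 < r by rewrite lt_min ltr01 divr_gt0.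
have r1 : r <= 1 by rewrite ge_min lexx.
have rK : r * (2 * K) <= eps by rewrite -ler_pdivlMr// ge_min lexx orbT.
have rr0 : 0 < r ^+ 2 by rewrite exprn_gt0.
have [s' [eta [eta0 sP]]] := small_remainder Mfac u1 pu tu aX rr0.
pose e := Num.min eta (eps / 2).
have e0 : 0 < e by rewrite lt_min eta0 divr_gt0.
have eeta : e <= eta by rewrite ge_min lexx.
have eeps : e <= eps / 2 by rewrite ge_min lexx orbT.
have [p [q [[pp pq] po [poq psum] [pc qc] pt]]] :=
  near_partition Mhyp u1 pu k.+1 delta (s ++ s') sa e0.
have qsmall tau : X tau -> rf tau q <= r ^+ 2.
  move=> Xt; apply: sP => // [x xs|i im].
    by rewrite (le_trans (qc x _))// mem_cat xs orbT.
  by have [_ h] := pt tau i Xt im; lra.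
have qN : N q <= r.
  apply: norm2_le_rf; first exact: ltW.
  by move=> tau Xt; case: pq => -> ->; exact: qsmall.
pose p' i := if i == 0 then p 0 + q else p i.
have [pq0 qp0] := poq 0 (ltn0Sn k).
exists p'; split.
- move=> i; rewrite /p'; case: ifP => // _.
  have [s0 pp0] := pp 0; have [sq qq] := pq; split; first by rewrite starD s0 sq.
  by rewrite smulDl !smulDr pp0 qq pq0 qp0 addr0 add0r.
- have po' i j : (i < k.+1)%N -> (j < k.+1)%N -> i != j -> p i ** p j = 0.
    rewrite neq_ltn => im jm /orP[ij|ij].
      by case: (po i j); rewrite ?ij.
    by case: (po j i); rewrite ?ij.
  move=> i j im jm ij; rewrite /p'.
  have [piq qpi] := poq i im; have [pjq qpj] := poq j jm.
  have [i0|i0] := eqVneq i 0; have [j0|j0] := eqVneq j 0.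
  + by move: ij; rewrite i0 j0.
  + by rewrite smulDl qpj po' ?addr0// -i0.
  + by rewrite smulDr piq po' ?addr0// -j0.
  + exact: po'.
- rewrite -psum !big_ord_recl /= /p' /= addrAC.
  by congr (_ + _ + _).
- move=> x i xs.
  have pcx j : N (p j ** x - x ** p j) <= e by apply: pc; rewrite mem_cat xs.
  have qcx : N (q ** x - x ** q) <= e by apply: qc; rewrite mem_cat xs.
  rewrite /p'; case: ifP => _; last by have := pcx i; lra.
  have -> : (p 0 + q) ** x - x ** (p 0 + q) =
      (p 0 ** x - x ** p 0) + (q ** x - x ** q).
    by rewrite smulDl smulDr opprD addrACA.
  by rewrite (le_trans (ler_norm2D _ _))//; have := pcx 0; lra.
- move=> tau i Xt im; have T := tc_tracial Xt; have [pti _] := pt tau i Xt im.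
  rewrite /p'; case: eqP => [i0|_]; last by lra.
  move: pti; rewrite i0 => pti.
  rewrite smulDr !(rfD T).
  have := rf_norm2_inner (a 0) q Xt; rewrite ler_norml => /andP[_ h1].
  have h2 : N (a 0) * N q <= N (a 0) * r by rewrite ler_wpM2l// norm2_ge0.
  have q0 := rf_projection_ge0 Xt pq.
  have h3 : - delta * rf tau q <= `|delta| * r.
    rewrite (le_trans (ler_norm _))// normrM normrN ler_wpM2l//.
    by rewrite ger0_norm// (le_trans (qsmall _ Xt))//; nra.
  move: rK; rewrite /K; lra.
Qed.

End local_partition.

(** * Closed and convex conditions on functionals; tails in free filters *)

Section order_and_topology.
Context {R : realType}.
Local Notation C := (R[i]^o).

Lemma Im_le_norm (z : R[i]) : ((`|complex.Im z|)%:C)%C <= `|z|.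
Proof.
have := normc_ge_Re (('i)%C * z).
by rewrite Re_iM normrN normrM (normc_def ('i)%C) /= expr0n expr1n add0r sqrtr1 mul1r.
Qed.

Lemma ulim_Re T (U : set_system T) {UU : UltraFilter U} (g : T -> C) (l : C) :
  g @ U --> l -> ulim U (fun t => complex.Re (g t)) (complex.Re l).
Proof.
move=> gl e e0; have ec : 0 < ((e%:C)%C : R[i]) by rewrite ltcR.
have Ut : U [set t | `|l - g t| < ((e%:C)%C : R[i])].
  by move/cvgrPdist_lt/(_ _ ec): gl.
apply: filterS Ut => t /= ht; rewrite distrC -ReB -ltcR (le_lt_trans _ ht)//.
exact: normc_ge_Re.
Qed.

Lemma ulim_Im T (U : set_system T) {UU : UltraFilter U} (g : T -> C) (l : C) :
  g @ U --> l -> ulim U (fun t => complex.Im (g t)) (complex.Im l).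
Proof.
move=> gl e e0; have ec : 0 < ((e%:C)%C : R[i]) by rewrite ltcR.
have Ut : U [set t | `|l - g t| < ((e%:C)%C : R[i])].
  by move/cvgrPdist_lt/(_ _ ec): gl.
apply: filterS Ut => t /= ht; rewrite distrC -ltcR (le_lt_trans _ ht)//.
rewrite (_ : complex.Im l - _ = complex.Im (l - g t)) ?Im_le_norm//.
by case: l (g t) {gl ht} => [? ?] [? ?].
Qed.

Lemma Re_continuous : continuous (fun z : C => complex.Re z : R).
Proof.
move=> z B /nbhs_ballP[e /= e0 eB]; apply/nbhs_ballP.
exists (e%:C)%C; first by rewrite /= ltcR.
move=> y zy; apply: eB; rewrite /ball/= -ReB -ltcR (le_lt_trans _ zy)//.
exact: normc_ge_Re.
Qed.

Lemma Im_continuous : continuous (fun z : C => complex.Im z : R).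
Proof.
move=> z B /nbhs_ballP[e /= e0 eB]; apply/nbhs_ballP.
exists (e%:C)%C; first by rewrite /= ltcR.
move=> y zy; apply: eB; rewrite /ball/= -ltcR (le_lt_trans _ zy)//.
rewrite (_ : complex.Im z - _ = complex.Im (z - y)) ?Im_le_norm//.
by case: z y {zy} => [? ?] [? ?].
Qed.

Lemma continuous_combination (T : topologicalType) (f g : T -> R) (r : R) :
  continuous f -> continuous g -> continuous (fun t => r * f t - g t).
Proof.
move=> cf cg t; apply: cvgB; last exact: cg.
by apply: cvgM; [exact: cvg_cst|exact: cf].
Qed.

(** The order of [R[i]] compares real parts and demands equal imaginary parts, so the set is an
    intersection of two closed conditions on real-valued continuous functions. *)
Lemma closed_le_functional (S : choiceType) (x y : S) (d : R) :
  closed ([set phi | phi x <= (d%:C)%C * phi y] : set {ptws S -> C}).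
Proof.
have ev z : continuous (fun phi : {ptws S -> C} => phi z) by exact: proj_continuous.
have cRe z : continuous (fun phi : {ptws S -> C} => complex.Re (phi z)).
  by move=> phi; apply: continuous_comp; [exact: ev|exact: Re_continuous].
have cIm z : continuous (fun phi : {ptws S -> C} => complex.Im (phi z)).
  by move=> phi; apply: continuous_comp; [exact: ev|exact: Im_continuous].
rewrite (_ : [set _ | _] =
  [set phi | 0 <= d * complex.Re (phi y) - complex.Re (phi x)] `&`
  [set phi | d * complex.Im (phi y) - complex.Im (phi x) = 0]); last first.
  apply/seteqP; split=> phi /=; rewrite lecE ReZ.
    case: (phi y) (phi x) => [y1 y2] [x1 x2] /= /andP[/eqP h1 h2].
    by split; lra.
  case: (phi y) (phi x) => [y1 y2] [x1 x2] /= [h1 h2].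
  by apply/andP; split; [apply/eqP; lra|lra].
have contRe := continuous_combination (r := d) (cRe y) (cRe x).
have contIm := continuous_combination (r := d) (cIm y) (cIm x).
apply: closedI.
- exact: (@preimage_closed {ptws S -> C} R _ [set r : R | 0 <= r]
    (fun phi _ => contRe phi) (@closed_ge R 0)).
- exact: (@preimage_closed {ptws S -> C} R _ [set r : R | r = 0]
    (fun phi _ => contIm phi) (@closed_eq R 0)).
Qed.

Lemma convex_le_functional (S : choiceType) (x y : S) (d : R[i]) :
  convex_set ([set phi | phi x <= d * phi y] :
    set (convex_lmodType (S -> C))).
Proof.
move=> phi psi l /set_mem/= hphi /set_mem/= hpsi; apply/mem_set => /=.
have l0 : 0 <= (l%:num : R[i]) by [].
have l1 : 0 <= 1 - (l%:num : R[i]) by rewrite subr_ge0.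
suff : l%:num * phi x + (1 - l%:num) * psi x <=
    d * (l%:num * phi y + (1 - l%:num) * psi y) by [].
rewrite mulrDr mulrCA (mulrCA d) lerD// ler_wpM2l//.
Qed.

(** Points are removed one at a time: by freeness some member of the filter misses [n]. *)
Lemma free_filter_ge (w : free_filter) n : ff_sets w [set m | (n <= m)%N].
Proof.
elim: n => [|n IH]; first by apply: filterS filterT.
have [B wB Bn] : exists2 B, ff_sets w B & ~ B n.
  apply: contrapT => h; have : (\bigcap_(B in ff_sets w) B) n.
    by move=> B wB; apply: contrapT => nB; apply: h; exists B.
  by rewrite ff_free.
apply: filterS2 IH wB => m /= nm Bm; rewrite ltn_neqAle nm andbT.
by apply/eqP => mn; apply: Bn; rewrite mn.
Qed.

End order_and_topology.

(** * The reduced power *)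

Section reduced_power_facts.
Context {R : realType} (M : tcAlgType R) (w : free_filter).
Local Notation C := (R[i]^o).
Local Notation X := (@tc_traces R M).
Local Notation N := (norm2 X).
Local Notation cl := (@redpow_class R M w).

Lemma redpow_smulE (x y : linf M) : cl x ** cl y = cl (x ** y).
Proof. by rewrite redpow_class_smul. Qed.

Lemma redpow_starE (x : linf M) : star (cl x) = cl (star x).
Proof. by rewrite redpow_class_star. Qed.

Lemma redpow_class0 : cl 0 = 0.
Proof. by apply: (addrI (cl 0)); rewrite -redpow_classD !addr0. Qed.

Lemma redpow_class_sum (I : finType) (F : I -> linf M) :
  \sum_i cl (F i) = cl (\sum_i F i).
Proof. by rewrite (big_morph cl (@redpow_classD R M w) redpow_class0). Qed.

Lemma linf_sumE (I : finType) (F : I -> linf M) n :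
  (\sum_i F i) n = \sum_i F i n.
Proof. exact: (big_morph (fun l : linf M => l n)). Qed.

Lemma contraction_bounded (b : nat -> M) : (forall n, rnorm (b n) <= 1) ->
  bounded_seq b.
Proof. by move=> b1; apply/bounded_seqP; exists 1 => n; rewrite normE lecR. Qed.

Lemma redpow_eq (x y : linf M) :
  (forall e : R, 0 < e -> exists n0 : nat, forall n, (n0 <= n)%N -> N (x n - y n) <= e) ->
  cl x = cl y.
Proof.
move=> xy; apply/redpow_classP/null_seqP/cvgrPdist_le => e e0.
have [n0 n0P] := xy e e0; apply: filterS (free_filter_ge w n0) => n /= /n0P h.
by rewrite sub0r normrN ger0_norm// norm2_ge0.
Qed.

(** The functionals satisfying the conclusion form a closed convex set, so only limit traces have to
    be examined; uniformity in [sigma] covers arbitrary sequences of traces. The imaginary parts are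
    controlled because the order of [R[i]] demands that they agree. *)
Lemma redpow_traces_le (x y : linf M) (d : R) (tau : redpow M w -> C) :
  (forall e : R, 0 < e -> exists n0 : nat, forall n sigma, (n0 <= n)%N -> X sigma ->
    [/\ complex.Im (sigma (x n)) = 0, complex.Im (sigma (y n)) = 0 &
        rf sigma (x n) <= d * rf sigma (y n) + e]) ->
  redpow_traces tau -> tau (cl x) <= (d%:C)%C * tau (cl y).
Proof.
move=> xy.
move=> /(_ [set phi : redpow M w -> C | phi (cl x) <= (d%:C)%C * phi (cl y)]).
apply; [exact: closed_le_functional|exact: convex_le_functional|].
move=> phi [sigma [U [sX UU wU sphi]]] /=.
have ev e : 0 < e -> U [set n |
    [/\ complex.Im (sigma n (x n)) = 0, complex.Im (sigma n (y n)) = 0 &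
        rf (sigma n) (x n) <= d * rf (sigma n) (y n) + e]].
  move=> /xy[n0 n0P]; apply: filterS (wU _ (free_filter_ge w n0)) => n /= nn.
  exact: n0P.
have Im0 (z : linf M) : U [set n | complex.Im (sigma n (z n)) = 0] ->
    complex.Im (phi (cl z)) = 0.
  move=> z0; apply: (ulim_eq (ulim_Im (sphi z)) (ulim_cst (U := U) 0)) => e e0.
  by apply: filterS z0 => n /= ->; rewrite subrr normr0 ltW.
have Ix : complex.Im (phi (cl x)) = 0.
  by apply: Im0; apply: filterS (ev 1 ltr01) => n [].
have Iy : complex.Im (phi (cl y)) = 0.
  by apply: Im0; apply: filterS (ev 1 ltr01) => n [].
rewrite lecE; apply/andP; split.
  by rewrite Ix; case: (phi (cl y)) Iy => s t /= ->; rewrite mulr0 mul0r addr0.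
rewrite ReZ; apply: (ulim_le (ulim_Re (sphi x)) (ulimZ d (ulim_Re (sphi y)))) => e e0.
by apply: filterS (ev e e0) => n [].
Qed.

End reduced_power_facts.

Theorem theorem8p3 (R : realType) (M : tcAlgType R) (w : free_filter) :
  hyperfinite M -> tc_factorial M -> CPoU M w.
Proof.
move=> Mhyp Mfac S k a delta [D [/countable_injP[g gD] DS Dd]] apos adelta.
have [u [u1 pu tu]] := exists_identity Mhyp.
(* Indices above [k] repeat [a ord0]. *)
pose b i := a (inord i : 'I_k.+1).
have bE (i : 'I_k.+1) : b i = a i by rewrite /b inord_val.
have sb i : star (b i) = b i.
  by rewrite /b; have [c ->] := apos (inord i); rewrite starM starK.
have bX tau : tc_traces tau -> exists2 i, (i < k.+1)%N & rf tau (b i) < delta.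
  move=> Xt; apply: contrapT => nex.
  have ge (i : 'I_k.+1) : delta <= rf tau (a i).
    rewrite leNgt; apply/negP => h; apply: nex; exists (i : nat); rewrite ?bE.
      exact: ltn_ord.
    exact: h.
  move: adelta; rewrite ltNge => /negP; apply.
  set E := [set _ | _ in _].
  (* Boundedness has to be shown, since [sup] is 0 on unbounded sets. *)
  have ubE : has_ubound E.
    exists (rnorm (a ord0)) => _ [sigma Xs <-].
    by rewrite (le_trans (bigmin_le_id _ _ _ _))// (rf_le_rnorm _ Xs).
  apply: le_trans (ub_le_sup ubE _); last by exists tau.
  by apply/bigmin_geP; split=> [|i _]; exact: ge.
(* An enumeration of [D] inverting the injection [g], with value 0 at indices that [g] does not
   reach. *)
pose d_ j := xget 0 [set x : M | D x /\ g x = j].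
have dD x : D x -> d_ (g x) = x.
  move=> Dx; have [Dy gy] : [set y : M | D y /\ g y = g x] (d_ (g x)).
    by apply: (@xgetPex _ _ [set y : M | D y /\ g y = g x]); exists x.
  by apply: gD => //; exact/mem_set.
pose c n : R := n.+1%:R^-1; have c0 n : 0 < c n by rewrite invr_gt0.
have small (e : R) : 0 < e -> exists n0 : nat, forall n, (n0 <= n)%N -> c n <= e.
  move=> e0; have [n0 _ n0P] := near_infty_natSinv_lt (PosNum e0).
  by exists n0 => n nn; apply/ltW/(n0P n nn).
(* Diagonal choice: the [n]-th partition has tolerance [1 / (n + 1)] and almost commutes with the
   first [n + 1] terms of the enumeration. Orthogonality and the sum hold exactly at every [n]. *)
have /(_ _)/cid-/all_sig[P PP] n := local_partition Mhyp Mfac u1 pu tu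
  [seq d_ j | j <- iota 0 n.+1] sb bX (c0 n).
have pP n i : projection (P n i) by case: (PP n).
have bnd i : bounded_seq (fun n => P n i).
  by apply: contraction_bounded => n; exact: rnorm_projection.
pose Q i : linf M := Linf (bnd i).
exists (fun i : 'I_k.+1 => redpow_class w (Q i)); split.
- move=> i; split.
    by rewrite redpow_starE; congr (redpow_class w _); apply: linf_eq => n; case: (pP n i).
  by rewrite redpow_smulE; congr (redpow_class w _); apply: linf_eq => n; case: (pP n i).
- move=> i s Ss; rewrite /redpow_cst !redpow_smulE; apply: redpow_eq => e e0 /=.
  have e4 : 0 < e / 4 by rewrite divr_gt0.
  have [d Dx sd] := Dd s _ Ss e4.
  (* Adding [g d] ensures that [d] is among the elements treated at stage [n]; the distance from [s]
     to [d] contributes twice [e / 4] to the commutator. *)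
  have [n0 n0P] := small _ e4; exists (n0 + g d)%N => n nn.
  have [_ _ _ com _] := PP n.
  have dn : d \in [seq d_ j | j <- iota 0 n.+1].
    rewrite -(dD d Dx) map_f// mem_iota add0n /= ltnS.
    by rewrite (leq_trans _ nn)// leq_addl.
  have := com d i dn; have := n0P n (leq_trans (leq_addr _ _) nn).
  have -> : P n i ** s - s ** P n i = (P n i ** d - d ** P n i) +
      (P n i ** (s - d) - (s - d) ** P n i).
    by rewrite smulBr smulBl [RHS]addrC opprB addrAC !subrKA.
  have := ler_norm2D (P n i ** d - d ** P n i)
    (P n i ** (s - d) - (s - d) ** P n i).
  have := ler_norm2B (P n i ** (s - d)) ((s - d) ** P n i).
  have := norm2_projl (s - d) (pP n i); have := norm2_projr (s - d) (pP n i).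
  lra.
- move=> i j ij; rewrite redpow_smulE -redpow_class0; congr (redpow_class w _).
  by apply: linf_eq => n /=; have [_ orth _ _ _] := PP n; exact: orth.
- have -> : \sum_(i < k.+1) redpow_class w (Q i) = redpow_class w (linf_cst u).
    rewrite redpow_class_sum; congr (redpow_class w _).
    by apply: linf_eq => n; rewrite linf_sumE /=; case: (PP n).
  move=> x; rewrite -(redpow_reprK x) !redpow_smulE.
  by split; congr (redpow_class w _); apply: linf_eq => n /=; case: (u1 (redpow_repr x n)).
- move=> tau i; rewrite /redpow_cst redpow_smulE; apply: redpow_traces_le => e e0 /=.
  have [n0 n0P] := small e e0; exists n0 => n sigma nn Xs.
  have T := tc_tracial Xs; have [_ _ _ _ le] := PP n.
  (* After use of the trace property, both arguments are squares, on which [sigma] is real. *)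
  have Im0 x : complex.Im (sigma (star x ** x)) = 0 by rewrite (tf_square T).
  split.
  + have [y ->] := apos i.
    by rewrite (tf_comm T) (corner_square _ T (pP n i)) Im0.
  + by have [sp <-] := pP n i; rewrite -{1}sp Im0.
  + have := le sigma i Xs (ltn_ord i); have := n0P n nn.
    by rewrite bE; lra.
Qed.
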